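(* Let $X$ be a normed vector space. Let $\Gamma:\mathcal P(\Sigma^{\mathbb N})\to X$ be continuous and affine and let $\Delta:\mathcal P(\Sigma^{\mathbb N})\to\mathbb R$ be continuous and affine with $\Delta(\mu)\neq0$ for all $\mu\in\mathcal P(\Sigma^{\mathbb N})$. Define $U:\mathcal P(\Sigma^{\mathbb N})\to X$ by $U=\frac{\Gamma}{\Delta}$. Let $C$ be a closed and convex subset of $X$ and assume that $$\overset{\circ}{C}\cap U\big(\mathcal P_S(\Sigma^{\mathbb N})\big)\neq\varnothing.$$ Let $\varphi:\Sigma^{\mathbb N}\to\mathbb R$ be a continuous function. (1) The lower and upper multifractal pressures $\underline P^U_C(\varphi)$ and $\overline P^U_C(\varphi)$ coincide, and their common value $P^U_C(\varphi)$ satisfies $$P^U_C(\varphi)=\sup_{\mu\in\mathcal P_S(\Sigma^{\mathbb N}),\ U\mu\in C}\Big(h(\mu)+\int\varphi\,d\mu\Big)=\sup_{\mu\in\mathcal P_S(\Sigma^{\mathbb N}),\ U\mu\in\overset{\circ}{C}}\Big(h(\mu)+\int\varphi\,d\mu\Big).$$ (2) We have $$-\log\sigma_{\mathrm{rad}}\big(\zeta^{\mathrm{dyn},U}_C(\varphi;\cdot)\big)=\sup_{\mu\in\mathcal P_S(\Sigma^{\mathbb N}),\ U\mu\in C}\Big(h(\mu)+\int\varphi\,d\mu\Big)=\sup_{\mu\in\mathcal P_S(\Sigma^{\mathbb N}),\ U\mu\in\overset{\circ}{C}}\Big(h(\mu)+\int\varphi\,d\mu\Big).$$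
   Context: Fix a positive integer $N$; $\Sigma^{\mathbb N}=\{1,\dots,N\}^{\mathbb N}$ is the space of infinite strings (product topology), $\Sigma^n=\{1,\dots,N\}^n$ the strings of length $n$; $|\mathbf i|$ is the length of a finite string $\mathbf i$ and $[\mathbf i]=\{\mathbf j\in\Sigma^{\mathbb N}: \mathbf j \text{ begins with } \mathbf i\}$ its cylinder. $S(i_1i_2\dots)=i_2i_3\dots$ is the shift. $\mathcal P(\Sigma^{\mathbb N})$ denotes the Borel probability measures on $\Sigma^{\mathbb N}$ and $\mathcal P_S(\Sigma^{\mathbb N})$ the shift-invariant ones, both with the weak topology (continuity of $\Gamma,\Delta$ refers to it); affine means $\Gamma(t\mu+(1-t)\nu)=t\Gamma(\mu)+(1-t)\Gamma(\nu)$ for $t\in[0,1]$. $h(\mu)$ is the measure-theoretic entropy of $\mu\in\mathcal P_S(\Sigma^{\mathbb N})$ with respect to $S$. For $n\ge1$ let $L_n:\Sigma^{\mathbb N}\to\mathcal P(\Sigma^{\mathbb N})$, $L_n\mathbf i=\frac1n\sum_{k=0}^{n-1}\delta_{S^k\mathbf i}$, and $UL_n[\mathbf i]=\{U(L_n\mathbf u):\mathbf u\in[\mathbf i]\}$. For $C\subseteq X$ and continuous $\varphi:\Sigma^{\mathbb N}\to\mathbb R$ put $$Z_n(C,\varphi)=\sum_{|\mathbf i|=n,\ UL_n[\mathbf i]\subseteq C}\ \sup_{\mathbf u\in[\mathbf i]}\exp\sum_{k=0}^{n-1}\varphi(S^k\mathbf u).$$ The lower and upper multifractal pressures are $\underline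 P^U_C(\varphi)=\liminf_n\frac1n\log Z_n(C,\varphi)$ and $\overline P^U_C(\varphi)=\limsup_n\frac1n\log Z_n(C,\varphi)$; if they coincide, the common value is written $P^U_C(\varphi)$. The dynamical multifractal zeta-function is the power series $\zeta_C^{\mathrm{dyn},U}(\varphi;z)=\sum_{n\ge1}\frac{z^n}{n}Z_n(C,\varphi)$, and $\sigma_{\mathrm{rad}}(f)\in[0,\infty]$ denotes the radius of convergence of a power series $f$. Empty sums are $0$ and $\log 0=-\infty$. $\overset{\circ}{C}$ is the interior of $C$. *)

(* Defs.v *)
From HB Require Import structures.
From mathcomp Require Import all_boot all_order all_algebra.
From mathcomp Require Import all_classical all_reals all_analysis.

Set Implicit Arguments.
Unset Strict Implicit.
Unset Printing Implicit Defensive.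

Import Order.TTheory GRing.Theory Num.Theory.
Import numFieldNormedType.Exports.
Local Open Scope classical_set_scope.
Local Open Scope ring_scope.

(* The alphabet is 'I_N.+1, so N.+1 ranges over the positive integers. *)
Definition strings (N : nat) : Type :=
  prod_topology (fun _ : nat => discrete_topology 'I_N.+1).

HB.instance Definition _ N := Topological.on (strings N).
HB.instance Definition _ N := isPointed.Build (strings N) (fun=> ord0).

(* Borel sigma-algebra *)
HB.instance Definition _ N := Measurable.copy (strings N)
  (g_sigma_algebraType (@open (strings N))).

Definition string_shift N (u : strings N) : strings N := fun n => u n.+1.

Definition cylinder N n (i : n.-tuple 'I_N.+1) : set (strings N) :=
  [set u | forall k : 'I_n, u k = tnth i k].

(* The coarsest topology making mu |-> \int f dmu continuous for every
   continuous f; since strings N is compact, such f are automatically bounded. *)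
Definition weak_probability (N : nat) (R : realType) : Type :=
  initial_topology (fun mu : probability (strings N) R =>
    (fun f : continuousType (strings N) R => \int[mu]_x f x)%R
    : prod_topology (fun _ : continuousType (strings N) R => R)).

HB.instance Definition _ N R := Topological.on (weak_probability N R).

Section convex_combination.
Context d (T : measurableType d) (R : realType).
Variables (t : {i01 R}) (mu nu : probability T R).

Definition pconv : set T -> \bar R :=
  measure_add (mscale (t%:num)%:nng mu) (mscale (1 - t%:num)%:nng nu).

HB.instance Definition _ := Measure.on pconv.

Let pconv_setT : pconv [set: T] = 1%E.
Proof.
rewrite /pconv measure_addE /= /mscale /= !probability_setT !mule1 -EFinD.
by rewrite addrC subrK.
Qed.

HB.instance Definition _ :=
  Measure_isProbability.Build _ _ _ pconv pconv_setT.

End convex_combination.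

Definition affine d (T : measurableType d) (R : realType) (V : lmodType R)
    (F : probability T R -> V) : Prop :=
  forall (t : {i01 R}) (mu nu : probability T R),
    F (pconv t mu nu) = t%:num *: F mu + (1 - t%:num) *: F nu.

Definition shift_invariant N (R : realType) (mu : probability (strings N) R) :=
  forall A, measurable A -> mu (@string_shift N @^-1` A) = mu A.

Section empirical_measure.
Context (R : realType) (N n : nat) (u : strings N).

(* L_n for n >= 1; by n.-1.+1 the (irrelevant) value at n = 0 is that of L_1. *)
Definition empirical : set (strings N) -> \bar R :=
  mscale (n.-1.+1%:R^-1 : R)%:nng
    (msum (fun k => \d_(iter k (@string_shift N) u)) n.-1.+1).

HB.instance Definition _ := Measure.on empirical.

Let empirical_setT : empirical [set: strings N] = 1%E.
Proof.
rewrite /empirical /mscale /= /msum /=.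
under eq_bigr do rewrite diracT.
by rewrite sumEFin sumr_const card_ord -EFinM mulVf.
Qed.

HB.instance Definition _ :=
  Measure_isProbability.Build _ _ _ empirical empirical_setT.

End empirical_measure.

(* Kolmogorov-Sinai entropy.  A finite measurable partition is encoded by its
   labelling xi : T -> 'I_m, whose fibres are the atoms (possibly empty). *)
Section entropy.
Context d (T : measurableType d) (R : realType).
Variables (S : T -> T) (mu : probability T R).

(* [ln 0 = 0], so null atoms contribute 0. *)
Definition partition_entropy (I : finType) (xi : T -> I) : R :=
  - \sum_(a : I) (fine (mu (xi @^-1` [set a])) *
                  ln (fine (mu (xi @^-1` [set a])))).

(* the labelling of the join of S^-j xi for j < n *)
Definition itinerary m (xi : T -> 'I_m) n (x : T) : {ffun 'I_n -> 'I_m} :=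
  [ffun j : 'I_n => xi (iter j S x)].

Definition entropy_wrt m (xi : T -> 'I_m) : R :=
  limn (fun n => n%:R^-1 * partition_entropy (@itinerary m xi n)).

Definition entropy : \bar R :=
  ereal_sup [set e | exists (m : nat) (xi : T -> 'I_m),
    (forall a, measurable (xi @^-1` [set a])) /\ e = (entropy_wrt xi)%:E].

End entropy.

Section multifractal.
Context (R : realType) (N : nat) (X : normedModType R).
Variables (U : probability (strings N) R -> X) (C : set X)
  (phi : strings N -> R).

Definition partition_function (n : nat) : R :=
  \sum_(i : n.-tuple 'I_N.+1 |
        `[< [set U (empirical R n u) | u in cylinder i] `<=` C >])
    sup [set expR (\sum_(k < n) phi (iter k (@string_shift N) u)) | u in cylinder i].

Definition lower_pressure : \bar R :=
  limn_einf (fun n => n%:R^-1%:E * lne (partition_function n)%:E)%E.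

Definition upper_pressure : \bar R :=
  limn_esup (fun n => n%:R^-1%:E * lne (partition_function n)%:E)%E.

(* coefficients of the zeta-function; the one of index 0 vanishes as 0^-1 = 0 *)
Definition zeta_coef (n : nat) : R := n%:R^-1 * partition_function n.

Definition variational_sup (D : set X) : \bar R :=
  ereal_sup [set (entropy (@string_shift N) mu + \int[mu]_x (phi x)%:E)%E
            | mu in [set mu | shift_invariant mu /\ D (U mu)]].

End multifractal.

(* The convergence points range over R only: for real coefficients this gives
   the same supremum as complex ones. *)
Definition radius_of_convergence (R : realType) (a : nat -> R) : \bar R :=
  ereal_sup [set `|z|%:E | z in [set z : R | cvgn (pseries a z)]].

(* Main.v *)
(** Weighting the admissible words of length n by exp(S_n phi) gives a
    probability nu_n on points whose empirical measures have U-value in C; as U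
    is a quotient of affine maps with denominator of constant sign and C is
    convex, the mixture mu_n of these empirical measures also satisfies
    U(mu_n) in C.  Gibbs' inequality against a Markov weight with kernel Q
    bounds (1/n) log Z_n by the mu_n-average of phi - log Q up to o(1).  A limit
    mu of the mu_n, built from its cylinder masses, is shift invariant, and the
    choice of Q as the conditional probabilities of mu turns the bound into
    H_(q+1)(mu) - H_q(mu) + int phi dmu for every q, hence h(mu) + int phi dmu.

    Conversely, if U(mu) is interior to C, concatenate independent blocks of
    length m drawn from mu: by the weak law of large numbers most of the
    resulting words have empirical measures weakly close to mu, hence are
    admissible, and there are about exp(n H_m(mu)/m) of them, where
    H_m(mu)/m >= h(mu, xi) for every partition xi.  No ergodic theorem is needed.

    Mixing with an invariant measure with U-value in the interior of C and using
    the concavity of entropy shows that the suprema over C and over its interior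
    agree; the zeta-function is then handled by the root test. *)
Require Import Defs.
From HB Require Import structures.
From mathcomp Require Import all_boot all_order all_algebra.
From mathcomp Require Import all_classical all_reals all_analysis.
From mathcomp Require Import measurable_realfun ring lra zify.

Set Implicit Arguments.
Unset Strict Implicit.
Unset Printing Implicit Defensive.

Import Order.TTheory GRing.Theory Num.Theory.
Import numFieldNormedType.Exports.
Local Open Scope classical_set_scope.
Local Open Scope ring_scope.

(** * Entropy of finite-valued labellings *)


(** The measures obtained from words of length n are not shift invariant, so their entropies cannot
    be used directly. Gibbs' inequality replaces them by the mean of a fixed function of q+1
    letters. Such a mean is linear in the measure and passes to the limit as soon as cylinder masses
    converge. The kernel Q is therefore built from the limit mu and tested afterwards against the
    approximating measures; it must be positive even on words that mu does not charge, since those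
    measures may charge them. A fixed q costs a constant, which division by n removes.

    Entropy is a supremum over all finite measurable partitions, whereas the pressures only see
    words. The upper bound gets by with the partition by the first letter. The lower bound has to
    show that no partition beats the block entropies: atoms are approximated by unions of cylinders,
    and the conditional entropy of a label given enough letters becomes small.

    Interiority enters because a concatenation reproduces only finitely many cylinder masses of mu,
    each up to a small error, so its U-value is merely near U(mu). *)

Lemma ln_le_sub1 (R : realType) (x : R) : 0 < x -> ln x <= x - 1.
Proof.
move=> x0; have := @le_ln1Dx R (x - 1); rewrite [1 + _]addrC subrK; apply.
by rewrite ltrBrDl subrr.
Qed.

(** Sum of [ln x <= x - 1] at x = q_i / p_i with weights p_i. As q may have smaller total mass than
    p, substochastic weights are allowed; positivity of q where p is positive keeps the convention
    [ln 0 = 0] from spoiling the bound. *)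
Lemma gibbs (R : realType) (I : finType) (p q : I -> R) :
  (forall i, 0 <= p i) -> (forall i, 0 <= q i) ->
  (forall i, 0 < p i -> 0 < q i) -> \sum_i q i <= \sum_i p i ->
  - (\sum_i p i * ln (p i)) <= - (\sum_i p i * ln (q i)).
Proof.
move=> p0 q0 pq sqp; rewrite lerN2 -subr_ge0 -sumrB.
apply: (@le_trans _ _ (\sum_i (p i - q i))); first by rewrite sumrB subr_ge0.
apply: ler_sum => i _; have [->|pN0] := eqVneq (p i) 0.
  by rewrite !mul0r subr0 sub0r oppr_le0.
have pi0 : 0 < p i by rewrite lt_neqAle eq_sym pN0 p0.
have qi0 := pq _ pi0.
rewrite -mulrBr -lerN2 !opprB -mulrN opprB -ln_div//.
have := ln_le_sub1 (divr_gt0 qi0 pi0) => /(ler_wpM2l (p0 i)) /le_trans; apply.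
by rewrite mulrBr mulr1 mulrCA divff// mulr1.
Qed.

Section finite_valued.
Context d (T : measurableType d) (R : realType) (mu : probability T R).

Definition measurable_label (I : Type) (X : T -> I) :=
  forall a, measurable (X @^-1` [set a]).

Definition law (I : Type) (X : T -> I) (a : I) : R :=
  fine (mu (X @^-1` [set a])).

Lemma prob_fin_num A : measurable A -> mu A \is a fin_num.
Proof. by move=> mA; exact: fin_num_measure. Qed.

Lemma law_ge0 I (X : T -> I) a : 0 <= law X a.
Proof. exact/fine_ge0/measure_ge0. Qed.

Lemma law_preimage (I : finType) (X : T -> I) (B : {pred I}) :
  measurable_label X ->
  measurable (X @^-1` [set` B]) /\
  fine (mu (X @^-1` [set` B])) = \sum_(a in B) law X a.
Proof.
move=> mX.
have -> : X @^-1` [set` B] = \bigcup_(a in [set` B]) X @^-1` [set a].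
  by apply/seteqP; split=> [x /= xB|x /= [a /= aB ->]//]; exists (X x).
have fB : finite_set [set` B] by exact: finite_finset.
split; first by apply: fin_bigcup_measurable => // i _; exact: mX.
rewrite measure_fin_bigcup//; last first.
  by move=> a b _ _ [x /= [ea eb]]; rewrite -ea -eb.
rewrite (_ : [set` B] = [set` enum B]); last first.
  by apply/seteqP; split=> x /=; rewrite mem_enum.
rewrite -fsbig_seq ?enum_uniq// big_enum/= -sum_fine// => a _.
exact/prob_fin_num/mX.
Qed.

Lemma measurable_label_comp (I J : finType) (X : T -> I) (f : I -> J) :
  measurable_label X -> measurable_label (f \o X).
Proof.
move=> mX b; have [] := @law_preimage _ X (fun a => f a == b) mX.
suff -> : (f \o X) @^-1` [set b] = X @^-1` [set` (fun a => f a == b) : {pred I}] by [].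
by apply/seteqP; split=> x /=; rewrite unfold_in => /eqP.
Qed.

Lemma law_comp (I J : finType) (X : T -> I) (f : I -> J) b :
  measurable_label X -> law (f \o X) b = \sum_(a | f a == b) law X a.
Proof.
move=> mX; have [_ <-] := @law_preimage _ X (fun a => f a == b) mX.
rewrite /law; congr (fine (mu _)).
by apply/seteqP; split=> x /=; rewrite unfold_in => /eqP.
Qed.

Lemma law_sum (I : finType) (X : T -> I) :
  measurable_label X -> \sum_a law X a = 1.
Proof.
move=> mX; have [_ <-] := @law_preimage _ X predT mX.
rewrite (_ : _ @^-1` _ = setT) ?probability_setT//.
by apply/seteqP; split.
Qed.

Lemma law_le1 (I : finType) (X : T -> I) a : measurable_label X -> law X a <= 1.
Proof.
move=> mX; rewrite -(law_sum mX) (bigD1 a)//= lerDl.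
by apply: sumr_ge0 => *; exact: law_ge0.
Qed.

Lemma law_expect (I J : finType) (X : T -> I) (f : I -> J) (g : J -> R) :
  measurable_label X ->
  \sum_a law X a * g (f a) = \sum_b law (f \o X) b * g b.
Proof.
move=> mX; rewrite (partition_big f predT)//=; apply: eq_bigr => b _.
by rewrite law_comp// mulr_suml; apply: eq_bigr => a /eqP ->.
Qed.

Lemma law_le_comp (I J : finType) (X : T -> I) (f : I -> J) a :
  measurable_label X -> law X a <= law (f \o X) (f a).
Proof.
move=> mX; rewrite law_comp// (bigD1 a)//= lerDl.
by apply: sumr_ge0 => *; exact: law_ge0.
Qed.

Definition pairing (I J : Type) (X : T -> I) (Y : T -> J) x := (X x, Y x).

Lemma measurable_label_pair (I J : finType) (X : T -> I) (Y : T -> J) :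
  measurable_label X -> measurable_label Y -> measurable_label (pairing X Y).
Proof.
move=> mX mY [a b].
rewrite (_ : _ @^-1` _ = X @^-1` [set a] `&` Y @^-1` [set b]).
  by apply: measurableI; [exact: mX|exact: mY].
by apply/seteqP; split=> x /=; rewrite /pairing => -[-> ->].
Qed.

Lemma law_marginal (I J : finType) (X : T -> I) (Y : T -> J) b :
  measurable_label X -> measurable_label Y ->
  \sum_a law (pairing X Y) (a, b) = law Y b.
Proof.
move=> mX mY; have mXY := measurable_label_pair mX mY.
rewrite [RHS](_ : _ = law (snd \o pairing X Y) b)// law_comp// [RHS]big_mkcond/=.
rewrite (eq_bigr (fun c : I * J => (fun a b' =>
  if b' == b then law (pairing X Y) (a, b') else 0) c.1 c.2)); last by case.
rewrite -(pair_bigA _ (fun a b' =>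
  if b' == b then law (pairing X Y) (a, b') else 0))/=.
by apply: eq_bigr => a _; rewrite -big_mkcond big_pred1_eq.
Qed.

Local Notation H X := (partition_entropy mu X).

Lemma entropyE (I : finType) (X : T -> I) :
  H X = - \sum_a law X a * ln (law X a).
Proof. by []. Qed.

Lemma entropy_ge0 (I : finType) (X : T -> I) : measurable_label X -> 0 <= H X.
Proof.
move=> mX; rewrite entropyE oppr_ge0; apply: sumr_le0 => a _.
by rewrite mulr_ge0_le0 ?law_ge0// ln_le0// law_le1.
Qed.

Lemma entropy_comp (I J : finType) (X : T -> I) (f : I -> J) :
  measurable_label X -> H (f \o X) <= H X.
Proof.
move=> mX; rewrite !entropyE lerN2.
rewrite -(@law_expect _ _ _ f (fun b => ln (law (f \o X) b)))//.
apply: ler_sum => a _; have := law_ge0 X a; rewrite le_eqVlt => /predU1P[<-|p0].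
  by rewrite !mul0r.
rewrite ler_pM2l// ler_ln ?posrE//; first exact: law_le_comp.
exact: lt_le_trans (law_le_comp _ _ _).
Qed.

(** Gibbs' inequality for the joint law against the weight [law Y b * Q a b]. The true conditional
    law gives equality, so every other kernel is a trial kernel for the conditional entropy. *)
Lemma cond_entropy_le (I J : finType) (X : T -> I) (Y : T -> J)
    (Q : I -> J -> R) :
  measurable_label X -> measurable_label Y ->
  (forall a b, 0 <= Q a b) -> (forall b, \sum_a Q a b <= 1) ->
  (forall a b, 0 < law (pairing X Y) (a, b) -> 0 < Q a b) ->
  H (pairing X Y) - H Y <=
  - \sum_c law (pairing X Y) c * ln (Q c.1 c.2).
Proof.
move=> mX mY Q0 Q1 Qp; have mXY := measurable_label_pair mX mY.
have YE : Y = snd \o pairing X Y by [].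
have le_Y c : law (pairing X Y) c <= law Y c.2.
  by rewrite {2}YE; exact: law_le_comp.
have EY : \sum_b law Y b * ln (law Y b) =
    \sum_c law (pairing X Y) c * ln (law Y c.2).
  exact: esym (@law_expect _ _ _ snd (fun b => ln (law Y b)) mXY).
rewrite lerBlDr !entropyE EY -opprD -big_split/=.
apply: (@le_trans _ _ (- (\sum_c law (pairing X Y) c *
    ln (law Y c.2 * Q c.1 c.2)))).
  apply: gibbs => [c|c|[a b] p0|].
  - exact: law_ge0.
  - by rewrite mulr_ge0// law_ge0.
  - by rewrite mulr_gt0 ?Qp// (lt_le_trans p0 (le_Y _)).
  - rewrite law_sum// -(law_sum mY).
    rewrite -(pair_big predT predT (fun a b => law Y b * Q a b))/=.
    rewrite exchange_big/=; apply: ler_sum => b _.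
    by rewrite -mulr_sumr ler_piMr// law_ge0.
rewrite lerN2; apply: ler_sum => -[a b] _ /=.
have := law_ge0 (pairing X Y) (a, b); rewrite le_eqVlt => /predU1P[<-|p0].
  by rewrite !mul0r addr0.
rewrite -mulrDr lnM ?posrE ?Qp//; last exact: (lt_le_trans p0 (le_Y _)).
by rewrite addrC.
Qed.

(** The conditional law of X given [f \o Y] serves as trial kernel for X given Y, so coarser
    conditioning can only raise the entropy. A constant f will give subadditivity. *)
Lemma cond_entropy_comp (I J K : finType) (X : T -> I) (Y : T -> J)
    (f : J -> K) :
  measurable_label X -> measurable_label Y ->
  H (pairing X Y) - H Y <= H (pairing X (f \o Y)) - H (f \o Y).
Proof.
move=> mX mY; have mfY := measurable_label_comp f mY.
have mXfY := measurable_label_pair mX mfY.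
have mXY := measurable_label_pair mX mY.
pose g (c : I * J) := (c.1, f c.2).
have gE : pairing X (f \o Y) = g \o pairing X Y by [].
pose Q a b := law (pairing X (f \o Y)) (a, f b) / law (f \o Y) (f b).
have law_fY k : \sum_a law (pairing X (f \o Y)) (a, k) = law (f \o Y) k.
  exact: law_marginal.
have lt0 a b : 0 < law (pairing X Y) (a, b) ->
    0 < law (pairing X (f \o Y)) (a, f b) /\ 0 < law (f \o Y) (f b).
  move=> p0; have p1 : 0 < law (pairing X (f \o Y)) (a, f b).
    by apply: lt_le_trans p0 _; rewrite gE; exact: (law_le_comp g (a, b)).
  split=> //; apply: lt_le_trans p1 _.
  exact: (law_le_comp snd (a, f b) mXfY).
have := @cond_entropy_le _ _ X Y Q mX mY; move=> /(_ _ _ _)/le_trans; apply.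
- by move=> a b; rewrite divr_ge0// law_ge0.
- move=> b; rewrite -mulr_suml law_fY.
  have [->|?] := eqVneq (law (f \o Y) (f b)) 0; first by rewrite mul0r.
  by rewrite divff.
- by move=> a b /lt0[? ?]; rewrite divr_gt0.
rewrite !entropyE opprK addrC.
have -> : \sum_k law (f \o Y) k * ln (law (f \o Y) k) =
    \sum_c law (pairing X Y) c * ln (law (f \o Y) (f c.2)).
  rewrite -(@law_expect _ _ Y f (fun k => ln (law (f \o Y) k)))//.
  exact: esym (@law_expect _ _ _ snd (fun b => ln (law (f \o Y) (f b))) mXY).
have -> : \sum_c law (pairing X (f \o Y)) c *
      ln (law (pairing X (f \o Y)) c) =
    \sum_c law (pairing X Y) c * ln (law (pairing X (f \o Y)) (g c)).
  exact: esym (@law_expect _ _ _ g (fun c => ln (law _ c)) mXY).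
rewrite -sumrB -sumrN; apply: ler_sum => -[a b] _ /=.
have := law_ge0 (pairing X Y) (a, b); rewrite le_eqVlt => /predU1P[<-|p0].
  by rewrite !mul0r subr0 oppr0.
by have [? ?] := lt0 _ _ p0; rewrite /Q ln_div// -mulrN opprB mulrBr.
Qed.

Lemma entropy_pair_le (I J : finType) (X : T -> I) (Y : T -> J) :
  measurable_label X -> measurable_label Y -> H (pairing X Y) <= H X + H Y.
Proof.
move=> mX mY; have := @cond_entropy_comp _ _ _ X Y (fun=> tt) mX mY.
rewrite lerBlDr => /le_trans; apply; rewrite lerD2r.
apply: (@le_trans _ _ (H (pairing X ((fun=> tt) \o Y)))).
  by rewrite gerBl entropy_ge0//; exact: measurable_label_comp.
have -> : pairing X ((fun=> tt) \o Y) = (fun a => (a, tt)) \o X by [].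
exact: entropy_comp.
Qed.

End finite_valued.

(** Fekete's lemma. With n = k m + r and r < m, the remainder a_r is bounded by a constant depending
    only on m, so a_n / n is asymptotically at most a_m / m; the limit is the infimum of these
    quotients, which nonnegativity makes finite. *)
Lemma fekete (R : realType) (a : nat -> R) :
  (forall n, 0 <= a n) -> (forall m n, a (m + n)%N <= a m + a n) ->
  cvgn (fun n => n%:R^-1 * a n) /\
  forall m, (0 < m)%N -> limn (fun n => n%:R^-1 * a n) <= m%:R^-1 * a m.
Proof.
move=> a0 sub.
pose E := [set x | exists2 m, (0 < m)%N & x = m%:R^-1 * a m].
have E0 : E !=set0 by exists (1%:R^-1 * a 1%N), 1%N.
have lbE : has_lbound E.
  by exists 0 => _ [m _ ->]; rewrite mulr_ge0// invr_ge0.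
have subM m k r : a (k * m + r)%N <= k%:R * a m + a r.
  elim: k => [|k IH]; first by rewrite mul0n add0n mul0r add0r.
  rewrite mulSn -addnA (le_trans (sub _ _))// -natr1 mulrDl mul1r.
  by rewrite addrAC [leRHS]addrC lerD2l.
suff cv : (fun n => n%:R^-1 * a n) @ \oo --> inf E.
  split; first by apply/cvg_ex; exists (inf E).
  move=> m m0; rewrite (cvg_lim _ cv)//; apply: inf_lbound => //; by exists m.
apply/cvgrPdist_le => /= e e0.
have [_ [m m0 ->] lem] := inf_adherent (divr_gt0 e0 (ltr0n R 2)) (conj E0 lbE).
pose B := \sum_(r < m) a r.
have aB r : (r < m)%N -> a r <= B.
  move=> rm; rewrite /B (bigD1 (Ordinal rm))//= lerDl.
  by apply: sumr_ge0.
have mR : 0 < m%:R :> R by rewrite ltr0n.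
near=> n.
have n0 : (0 < n)%N by near: n; exists 1%N.
have nR : 0 < n%:R :> R by rewrite ltr0n.
have leE : inf E <= n%:R^-1 * a n by apply: inf_lbound => //; exists n.
rewrite distrC ger0_norm ?subr_ge0//.
have BE : B <= n%:R * (e / 2).
  by rewrite -ler_pdivrMr ?divr_gt0//; near: n; exact: nbhs_infty_ger.
have h : a n <= n%:R * (m%:R^-1 * a m) + B.
  rewrite {1}(divn_eq n m) (le_trans (subM _ _ _))// lerD ?aB ?ltn_mod//.
  rewrite mulrA ler_wpM2r// ler_pdivlMr// -natrM ler_nat; exact: leq_trunc_div.
rewrite lerBlDr -(ler_pM2l nR) mulrA divff ?gt_eqF// mul1r (le_trans h)//.
have : n%:R * (m%:R^-1 * a m) <= n%:R * (inf E + e / 2).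
  by rewrite ler_wpM2l// ltW.
move=> h2; move: BE h2; rewrite !mulrDr; lra.
Unshelve. all: by end_near. Qed.

(** * Cylinders and the weak topology *)


Lemma integral_label d (T : measurableType d) (R : realType)
    (mu : probability T R) (I : finType) (X : T -> I) (F : I -> R) :
  measurable_label X ->
  mu.-integrable setT (EFin \o (F \o X)) /\
  (\int[mu]_x (F (X x)))%R = \sum_a law mu X a * F a.
Proof.
move=> mX; pose f a x := ((F a)%:E * (\1_(X @^-1` [set a]) x)%:E)%E.
have fE x : (F (X x))%:E = (\sum_a f a x)%E.
  rewrite /f (bigD1 (X x))//= indicE mem_set//= mule1 big1 ?adde0// => a aX.
  by rewrite indicE memNset/= ?mule0//; apply/eqP; rewrite eq_sym.
have intf a : mu.-integrable setT (f a).
  by apply: integrableZl => //; apply: integrable_indic; exact: mX.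
split.
  rewrite (_ : _ \o _ = (fun x => \sum_a f a x)%E).
    by apply: integrable_sum => // a _.
  by apply/funext => x; rewrite -fE.
rewrite /Rintegral; under eq_integral do rewrite fE.
rewrite integral_sum//.
rewrite (eq_bigr (fun a => (law mu X a * F a)%:E)) ?sumEFin// => a _.
rewrite /f integralZl//; last exact/integrable_indic/mX.
rewrite integral_indic// setIT EFinM muleC /law fineK//.
exact/prob_fin_num/mX.
Qed.

Section prefixes.
Context (N : nat).
Local Notation A := 'I_N.+1.
Local Notation Sig := (strings N).
Local Notation sft := (@string_shift N).
Implicit Types (u v : Sig).

Definition prefix n u : n.-tuple A := [tuple u i | i < n].

(** Padding with [ord0] picks a point in each cylinder. Functions of words become functions of
    strings, and prefixes of words are taken without casts between tuple types. *)
Definition extend n (w : n.-tuple A) : Sig := fun k => nth ord0 w k.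

Lemma prefixP n u v :
  prefix n u = prefix n v <-> (forall k, (k < n)%N -> u k = v k).
Proof.
split=> [e k kn|e].
  by have := congr1 (fun w => tnth w (Ordinal kn)) e; rewrite !tnth_mktuple.
by apply: eq_mktuple => i; exact: e.
Qed.

Lemma prefix_extend n (w : n.-tuple A) : prefix n (extend w) = w.
Proof.
by apply: eq_from_tnth => i; rewrite tnth_mktuple /extend -tnth_nth.
Qed.

Lemma prefix_le n m u v : (n <= m)%N -> prefix m u = prefix m v ->
  prefix n u = prefix n v.
Proof.
by move=> nm /prefixP e; apply/prefixP => k kn; apply: e; exact: leq_trans nm.
Qed.

Lemma cylinderE n (w : n.-tuple A) : cylinder w = prefix n @^-1` [set w].
Proof.
apply/seteqP; split=> u /= h.
  by apply: eq_from_tnth => i; rewrite tnth_mktuple h.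
by move=> i; rewrite -h tnth_mktuple.
Qed.

Lemma iter_shiftE k u i : iter k sft u i = u (k + i)%N.
Proof. by elim: k i => // k IH i /=; rewrite /string_shift IH addnS. Qed.

Lemma nbhs_prefix n u : nbhs u (fun v : Sig => prefix n v = prefix n u).
Proof.
have := @filter_forall Sig 'I_n (fun i v => v i = u i) (nbhs u)
  (nbhs_filter u) (fun i => @proj_continuous nat (fun=> discrete_topology A) i u
  [set u i] (discrete_set1 _)).
by move/filterS; apply=> v h; apply: eq_mktuple.
Qed.

Lemma open_prefix n (B : set (n.-tuple A)) : open (prefix n @^-1` B : set Sig).
Proof.
rewrite openE => u /= Bu; rewrite /interior.
by apply: filterS (nbhs_prefix n u) => v /= ->.
Qed.

(** The candidate for the neighbourhood filter of u. Its convergence to u in the product topology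
    can be tested one coordinate at a time, and this shows that cylinders form a base of
    neighbourhoods. *)
Definition prefix_filter u : set_system Sig :=
  [set B | exists n, forall v, prefix n v = prefix n u -> B v].

Lemma prefix_filterP u : Filter (prefix_filter u).
Proof.
split.
- by exists 0%N.
- move=> P Q [n nP] [m mQ]; exists (maxn n m) => v e; split.
    by apply: nP; apply: prefix_le e; exact: leq_maxl.
  by apply: mQ; apply: prefix_le e; exact: leq_maxr.
- by move=> P Q PQ [n nP]; exists n => v /nP /PQ.
Qed.

Lemma nbhs_stringsP u (B : set Sig) : nbhs u B ->
  exists n, forall v, prefix n v = prefix n u -> B v.
Proof.
have FF := prefix_filterP u.
suff : prefix_filter u --> u by move=> /[apply].
apply/cvg_sup => i P [_ [[/= Q oQ <-] /= Qu QP]].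
exists i.+1 => v /prefixP /(_ i (ltnSn _)) e; apply: QP => /=.
by rewrite e.
Qed.

Lemma measurable_prefix n : measurable_label (prefix n : Sig -> _).
Proof. by move=> w; apply: sub_sigma_algebra; exact: open_prefix. Qed.

Lemma measurable_cylinder n (w : n.-tuple A) : measurable (cylinder w).
Proof. by rewrite cylinderE; exact: measurable_prefix. Qed.

Definition cylinders : set_system Sig :=
  [set B | exists n (w : n.-tuple A), B = cylinder w].

(** There are only countably many words, so an open set is a countable union of cylinders. Adjoining
    the empty set makes the generating family stable under intersection. *)
Lemma measurable_cylinders :
  (measurable : set_system Sig) = <<s cylinders `|` [set set0] >>.
Proof.
apply/seteqP; split; apply: smallest_sub.
- exact: smallest_sigma_algebra.
- move=> B oB.
  pose I := {n : nat & n.-tuple A}.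
  have -> : B = \bigcup_(i in [set i : I | cylinder (projT2 i) `<=` B])
      cylinder (projT2 i).
    apply/seteqP; split=> [u Bu|u [i /= iB] /iB//].
    have /nbhs_stringsP [n nB] : nbhs u B by apply: open_nbhs_nbhs.
    exists (existT _ n (prefix n u)) => /=.
      by rewrite cylinderE => v /= /nB.
    by rewrite cylinderE.
  rewrite bigcup_mkcond.
  apply: (@countable_bigcupT_measurable _
    (g_sigma_algebraType (cylinders `|` [set set0]))).
    exact: (@countableP {n : nat & n.-tuple A}).
  move=> i; case: ifP => _; last exact: (@measurable0 _
    (g_sigma_algebraType (cylinders `|` [set set0]))).
  by apply: sub_gen_smallest; left; exists (projT1 i), (projT2 i).
- split; first exact: measurable0.
  - by move=> B mB; rewrite setTD; exact: measurableC.
  - by move=> F mF; exact: bigcupT_measurable.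
- move=> B [[n [w ->]]|->]; last exact: measurable0.
  exact: measurable_cylinder.
Qed.
End prefixes.


Section weak_topology.
Context (N : nat) (R : realType).
Local Notation A := 'I_N.+1.
Local Notation Sig := (strings N).
Local Notation sft := (@string_shift N).
Implicit Types (u v : Sig) (nu mu : probability Sig R).

Lemma compact_strings : compact [set: Sig].
Proof.
have fin (_ : nat) : compact [set: discrete_topology A].
  by apply: finite_compact; exact: (@finite_finset A setT).
have := @tychonoff nat (fun=> discrete_topology A) (fun=> setT) fin.
by rewrite (_ : [set f | _] = setT)//; apply/seteqP; split.
Qed.

(* Otherwise pairs agreeing on ever longer prefixes would accumulate, by
   compactness, at a point of discontinuity. *)
Lemma uniform_oscillation (f : Sig -> R) (e : R) : continuous f -> 0 < e ->
  exists q, forall u v, prefix q u = prefix q v -> `|f u - f v| <= e.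
Proof.
move=> cf e0; apply: contrapT => /forallNP bad.
have /choice[p pP] q : exists p : Sig * Sig,
    prefix q p.1 = prefix q p.2 /\ e < `|f p.1 - f p.2|.
  have /existsNP[u /existsNP[v /not_implyP[uv /negP]]] := bad q.
  by rewrite -ltNge => h; exists (u, v).
have [x [_ clx]] := compact_strings (fmap_proper_filter (fst \o p)
  eventually_filter) filterT.
have e20 : 0 < e / 2 by rewrite divr_gt0.
have /cvgrPdist_lt/(_ _ e20)/nbhs_stringsP[n nP] := cf x.
have ev : ((fst \o p) @ \oo) [set u | exists2 q, (n <= q)%N & u = (p q).1].
  by exists n => // q /= nq; exists q.
have [_ [[q nq ->] /= qx]] := clx _ _ ev (nbhs_prefix n x).
have [pe] := pP q; apply/negP; rewrite -leNgt.
have := nP _ qx; have := nP (p q).2; rewrite -(prefix_le nq pe) => /(_ qx).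
rewrite -[X in _ -> _ -> X <= _](_ : `|(f x - f (p q).2) - (f x - f (p q).1)| = _).
  move=> h1 h2; apply: le_trans (ler_normB _ _) _.
  by rewrite [leRHS]splitr; apply: lerD; exact: ltW.
by congr (`| _ |); lra.
Qed.

Lemma continuous_measurable (f : Sig -> R) : continuous f ->
  measurable_fun [set: Sig] f.
Proof.
move=> /continuousP cf; apply: (measurability _ (RGenOpens.measurableE R)).
move=> _ [_ [x [y ->]] <-]; rewrite setTI; apply: sub_sigma_algebra.
exact/cf/interval_open.
Qed.

Lemma continuous_bounded (f : Sig -> R) : continuous f ->
  exists2 M, 0 <= M & forall u, `|f u| <= M.
Proof.
move=> cf; have [q qP] := uniform_oscillation cf (@ltr01 R).
exists (1 + \sum_(w : q.-tuple A) `|f (extend w)|).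
  by rewrite addr_ge0//; apply: sumr_ge0.
move=> u; rewrite -[f u](subrK (f (extend (prefix q u)))).
apply: le_trans (ler_normD _ _) _; apply: lerD.
  by apply: qP; rewrite prefix_extend.
rewrite (bigD1 (prefix q u))//= lerDl.
by apply: sumr_ge0.
Qed.

Lemma continuous_integrable (f : Sig -> R) nu : continuous f ->
  nu.-integrable setT (EFin \o f).
Proof.
move=> cf; apply: measurable_bounded_integrable => //.
- by rewrite (le_lt_trans (probability_le1 _ _))// ltry.
- exact: continuous_measurable.
- have [M _ fM] := continuous_bounded cf.
  by exists M; split; [exact: num_real|move=> y My u _; exact: (le_trans (fM u) (ltW My))].
Qed.

Definition mass nu n (w : n.-tuple A) : R := law nu (prefix n) w.

(** Integrals of continuous functions are reduced to finitely many cylinder masses; neither q nor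
    the error depends on the measure, so the estimate holds uniformly along sequences of
    measures. *)
Lemma integral_approx (f : Sig -> R) nu q e : continuous f ->
  (forall u v, prefix q u = prefix q v -> `|f u - f v| <= e) ->
  `|\int[nu]_x f x - \sum_(w : q.-tuple A) mass nu w * f (extend w)| <= e.
Proof.
move=> cf osc.
have [intg <-] := integral_label nu (f \o @extend N q) (@measurable_prefix N q).
have intf := continuous_integrable nu cf.
rewrite -RintegralB//.
have intB : nu.-integrable setT
    (EFin \o (fun x => f x - f (extend (prefix q x)))).
  have := integrableB measurableT intf intg.
  by apply: eq_integrable => // x _; rewrite /= EFinB.
apply: le_trans (le_normr_Rintegral measurableT intB) _.
rewrite -[leRHS]mulr1 -[X in _ * X](_ : fine (nu setT) = 1); last first.
  by rewrite probability_setT.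
rewrite -Rintegral_cst//; apply: le_Rintegral => //.
- have := integrable_abse intB.
  by apply: eq_integrable.
- by apply: finite_measure_integrable_cst.
- by move=> x _; apply: osc; rewrite prefix_extend.
Qed.

Lemma mass_ge0 nu n (w : n.-tuple A) : 0 <= mass nu w.
Proof. exact: law_ge0. Qed.

Lemma mass_sum1 nu n : \sum_(w : n.-tuple A) mass nu w = 1.
Proof. by apply: law_sum; exact: measurable_prefix. Qed.

Lemma mass_prefix nu n m (w : n.-tuple A) : (n <= m)%N ->
  mass nu w = \sum_(w' : m.-tuple A | prefix n (extend w') == w) mass nu w'.
Proof.
move=> nm; rewrite /mass -law_comp; last exact: measurable_prefix.
congr (law nu _ w); apply/funext => u /=.
by apply: (prefix_le nm); rewrite prefix_extend.
Qed.

Definition close_prefix mu q d nu :=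
  forall w : q.-tuple A, `|mass nu w - mass mu w| < d.

(** The mass of a word of length n is a sum over some of the words of length m, so the tolerance is
    divided by their number; the successor makes the final bound strict. *)
Lemma close_prefix_le mu n m d nu : (n <= m)%N ->
  close_prefix mu m (d / (#|{: m.-tuple A}|.+1)%:R) nu -> 0 < d ->
  close_prefix mu n d nu.
Proof.
move=> nm h d0 w; rewrite !(mass_prefix _ w nm) -sumrB.
apply: le_lt_trans (ler_norm_sum _ _ _) _.
apply: (@le_lt_trans _ _ (\sum_(w' : m.-tuple A)
    d / (#|{: m.-tuple A}|.+1)%:R)).
  rewrite big_mkcond/=; apply: ler_sum => w' _; case: ifP => _.
    exact/ltW/h.
  by rewrite divr_ge0// ltW.
rewrite sumr_const -[ltLHS]mulr_natr mulrAC ltr_pdivrMr ?ltr0n//.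
by rewrite ltr_pM2l// ltr_nat.
Qed.

(** Every weak neighbourhood of mu will be shown to contain one of these sets. This direction
    transfers the continuity of U to statements about cylinder masses. *)
Definition weak_filter mu : set_system (weak_probability N R) :=
  [set B | exists q d, 0 < d /\ forall nu, close_prefix mu q d nu -> B nu].

Lemma weak_filterP mu : Filter (weak_filter mu).
Proof.
split.
- by exists 0%N, 1.
- move=> P Q [n [d [d0 nP]]] [m [e [e0 mQ]]].
  pose k := maxn n m; pose c := (#|{: k.-tuple A}|.+1)%:R : R.
  have c0 : 0 < c by rewrite ltr0n.
  exists k, (Num.min d e / c); split; first by rewrite divr_gt0// lt_min d0.
  move=> nu cl; split.
    apply: nP; apply: (close_prefix_le (leq_maxl n m)) => // w.
    by apply: lt_le_trans (cl w) _; rewrite ler_pM2r ?invr_gt0// ge_min lexx.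
  apply: mQ; apply: (close_prefix_le (leq_maxr n m)) => // w.
  by apply: lt_le_trans (cl w) _; rewrite ler_pM2r ?invr_gt0// ge_min lexx orbT.
- by move=> P Q PQ [n [d [d0 nP]]]; exists n, d; split=> // nu /nP /PQ.
Qed.

Lemma weak_filter_cvg mu : weak_filter mu --> (mu : weak_probability N R).
Proof.
have FF := weak_filterP mu.
pose I (nu : weak_probability N R) : prod_topology
  (fun _ : continuousType Sig R => R) := fun f => (\int[nu]_x f x)%R.
have cv : I @ weak_filter mu --> I mu.
  apply/cvg_sup => f B [_ [[/= Q oQ <-] /= Qf QB]].
  apply: filterS QB _.
  have [e /= e0 eQ] : nbhs_ball (I mu f) Q.
    by apply/nbhs_ballP; apply: open_nbhs_nbhs.
  have e30 : 0 < e / 3 by rewrite divr_gt0.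
  have [q qP] := uniform_oscillation (@cts_fun _ _ f) e30.
  (* c exceeds the sum of the absolute values of f on words, so the change of masses contributes
     less than [e / 3]; approximating the two integrals takes the other two thirds. *)
  pose c := 1 + \sum_(w : q.-tuple A) `|f (extend w)|.
  have c0 : 0 < c by rewrite ltr_pwDl// sumr_ge0.
  exists q, (e / 3 / c); split; first by rewrite divr_gt0.
  move=> nu cl; apply: eQ; rewrite /ball/= /I.
  have h1 := integral_approx mu (@cts_fun _ _ f) qP.
  have h2 := integral_approx nu (@cts_fun _ _ f) qP.
  have h3 : `|\sum_(w : q.-tuple A) mass nu w * f (extend w) -
      \sum_(w : q.-tuple A) mass mu w * f (extend w)| < e / 3.
    rewrite -sumrB; apply: le_lt_trans (ler_norm_sum _ _ _) _.
    apply: (@le_lt_trans _ _ (e / 3 / c * (c - 1))).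
      rewrite /c addrAC subrr add0r mulr_sumr; apply: ler_sum => w _.
      by rewrite -mulrBl normrM ler_wpM2r// ltW.
    rewrite mulrBr mulr1 divfK ?gt_eqF// ltrBlDr ltrDl.
    by rewrite divr_gt0.
  move: h1 h2 h3; rewrite !ler_norml !ltr_norml => /andP[? ?] /andP[? ?] /andP[? ?].
  by apply/andP; split; lra.
move=> P [_ [[Q oQ <-] Qmu QP]].
have /cv wQ : nbhs (I mu) Q by apply: open_nbhs_nbhs.
exact: (@filterS _ _ FF _ _ QP wQ).
Qed.

Lemma weak_continuous_nbhs (Y : topologicalType)
    (U : probability Sig R -> Y) mu (O : set Y) :
  continuous (U : weak_probability N R -> Y) -> nbhs (U mu) O ->
  exists q d, 0 < d /\ forall nu, close_prefix mu q d nu -> O (U nu).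
Proof. by move=> cU /cU /weak_filter_cvg. Qed.



End weak_topology.


(** * Shift invariance tested on cylinders *)

Section probability_aux.
Context d (T : measurableType d) (R : realType) (mu : probability T R).

Lemma pushforward_probability d' (T' : measurableType d') (f : T -> T') :
  measurable_fun [set: T] f ->
  exists m : probability T' R, forall B, m B = mu (f @^-1` B).
Proof.
move=> mf; pose F := [the {mfun T >-> T'} of mfun_Sub (mem_set mf)].
by exists (distribution mu F).
Qed.

Lemma prob_le (B C : set T) : measurable B -> measurable C -> B `<=` C ->
  fine (mu B) <= fine (mu C).
Proof.
move=> mB mC BC; apply: fine_le; [exact: prob_fin_num..|].
by apply: le_measure; rewrite ?inE.
Qed.

Lemma prob_setU_le (B C : set T) : measurable B -> measurable C ->
  fine (mu (B `|` C)) <= fine (mu B) + fine (mu C).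
Proof.
move=> mB mC; rewrite -fineD; [|exact: prob_fin_num..].
apply: fine_le; first exact/prob_fin_num/measurableU.
  by rewrite fin_numD !prob_fin_num.
exact: measureU2.
Qed.

End probability_aux.

Section shift_measurability.
Context (N : nat) (R : realType).
Local Notation A := 'I_N.+1.
Local Notation Sig := (strings N).
Local Notation sft := (@string_shift N).
Implicit Types (u v : Sig) (nu mu : probability Sig R).

Lemma prefix_shift n u : prefix n (sft u) = prefix n (sft (extend (prefix n.+1 u))).
Proof.
apply/prefixP => k kn; rewrite /string_shift.
have /prefixP -> // : prefix n.+1 u = prefix n.+1 (extend (prefix n.+1 u)).
by rewrite prefix_extend.
Qed.

Lemma measurable_shift : measurable_fun [set: Sig] sft.
Proof.
apply: (measurability _ (measurable_cylinders N)).
move=> _ [_ [[n [w ->]]|->] <-]; rewrite setTI; last by rewrite preimage_set0.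
rewrite cylinderE (_ : sft @^-1` _ = prefix n.+1 @^-1`
  [set w' | prefix n (sft (extend w')) = w]); last first.
  by apply/seteqP; split => u /=; rewrite -prefix_shift.
by apply: sub_sigma_algebra; exact: open_prefix.
Qed.

Lemma measurable_iter_shift k : measurable_fun [set: Sig] (iter k sft).
Proof.
elim: k => [|k IH]; first exact: measurable_id.
rewrite (_ : iter k.+1 sft = sft \o iter k sft)//.
exact: measurableT_comp measurable_shift IH.
Qed.

Lemma measurable_label_shift (I : Type) (X : Sig -> I) k :
  measurable_label X -> measurable_label (X \o iter k sft).
Proof.
move=> mX a; rewrite -[X in measurable X]setTI.
by apply: (measurable_iter_shift k measurableT (mX a)).
Qed.

Lemma invariant_iter mu k (B : set Sig) : shift_invariant mu -> measurable B ->
  mu (iter k sft @^-1` B) = mu B.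
Proof.
move=> inv; elim: k B => // k IH B mB.
rewrite -(inv B mB) -(IH (sft @^-1` B))//.
by rewrite -[X in measurable X]setTI; exact: measurable_shift.
Qed.

Lemma law_shift mu (I : Type) (X : Sig -> I) k : shift_invariant mu ->
  measurable_label X -> law mu (X \o iter k sft) = law mu X.
Proof.
move=> inv mX; apply/funext => a; rewrite /law.
by rewrite -(invariant_iter k inv (mX a)).
Qed.

Lemma law_prefix_shift mu n (w : n.-tuple A) :
  law mu (prefix n \o sft) w =
  \sum_(w' : n.+1.-tuple A | prefix n (sft (extend w')) == w) mass mu w'.
Proof.
rewrite /mass -law_comp; last exact: measurable_prefix.
by congr (law mu _ w); apply/funext => u /=; exact: prefix_shift.
Qed.

(** Both mu and its image under the shift are determined by their values on an intersection-stable
    generating family, here the cylinders with the empty set: two cylinders are nested or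
    disjoint. *)
Lemma shift_invariantP mu :
  (forall n (w : n.-tuple A), law mu (prefix n \o sft) w = mass mu w) ->
  shift_invariant mu.
Proof.
move=> h; have [m mE] := pushforward_probability mu measurable_shift.
move=> B mB; rewrite -mE.
apply: (measure_unique (@cylinders N `|` [set set0]) (fun=> setT)
  (measurable_cylinders N) _ _ _ m mu) => //.
- have setIs n p (w : n.-tuple A) (w' : p.-tuple A) : (n <= p)%N ->
      (@cylinders N `|` [set set0]) (cylinder w `&` cylinder w').
    move=> np; have [e|ne] := pselect (prefix n (extend w') = w).
      left; exists p, w'; rewrite setIidr// !cylinderE => u /= uw'.
      rewrite -e; apply: (prefix_le np).
      by rewrite uw' prefix_extend.
    right; apply/seteqP; split=> // u; rewrite !cylinderE => -[/= uw uw'].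
    apply: ne; rewrite -uw; apply: (prefix_le np).
    by rewrite uw' prefix_extend.
  move=> _ _ [[n [w ->]]|->] [[p [w' ->]]|->]; rewrite ?set0I ?setI0; try by right.
  by case: (leqP n p) => [|/ltnW] np; [|rewrite setIC]; apply: setIs.
- move=> _; left; exists 0%N, [tuple].
  by apply/seteqP; split=> // u _ [].
- by rewrite bigcup_const.
- move=> _ [[n [w ->]]|->]; last by rewrite !measure0.
  transitivity (mu (sft @^-1` cylinder w)); first exact: mE.
  have f1 := prob_fin_num mu (measurable_prefix w).
  have f2 := prob_fin_num mu (measurable_label_shift 1 (@measurable_prefix N n) w).
  by have := congr1 EFin (h n w); rewrite /mass /law !fineK// cylinderE.
- by move=> k; apply: le_lt_trans (probability_le1 m measurableT) (ltry _).
Qed.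

End shift_measurability.

(** * Approximation of measurable sets by unions of cylinders *)

Section approximation.
Context (N : nat) (R : realType) (mu : probability (strings N) R).
Local Notation A := 'I_N.+1.
Local Notation Sig := (strings N).

Local Notation pr B := (fine (mu B)).

(** The sets with this property form a sigma-algebra that contains the cylinders, hence every
    measurable set has it. *)
Definition approximable (B : set Sig) := measurable B /\
  forall e : R, 0 < e ->
  exists q (D : set (q.-tuple A)), pr (B `+` prefix q @^-1` D) < e.

Lemma measurable_prefix_set q (D : set (q.-tuple A)) :
  measurable (prefix q @^-1` D : set Sig).
Proof. by apply: sub_sigma_algebra; exact: open_prefix. Qed.

Lemma measurable_setY (B C : set Sig) :
  measurable B -> measurable C -> measurable (B `+` C).
Proof. by move=> mB mC; rewrite setY_def; apply: measurableU; apply: measurableD. Qed.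

Lemma approximableU B1 B2 :
  approximable B1 -> approximable B2 -> approximable (B1 `|` B2).
Proof.
move=> [m1 a1] [m2 a2]; split; first exact: measurableU.
move=> e e0; have e20 : 0 < e / 2 by rewrite divr_gt0.
have [q1 [D1 h1]] := a1 _ e20; have [q2 [D2 h2]] := a2 _ e20.
pose q := maxn q1 q2.
have pE n (u : Sig) : (n <= q)%N -> prefix n (extend (prefix q u)) = prefix n u.
  by move=> nq; apply: (prefix_le nq); rewrite prefix_extend.
exists q, [set w | D1 (prefix q1 (extend w)) \/ D2 (prefix q2 (extend w))].
rewrite [e]splitr; apply: le_lt_trans (ltrD h1 h2).
have mY B n (D : set (n.-tuple A)) : measurable B ->
    measurable (B `+` prefix n @^-1` D).
  by move=> mB; apply: measurable_setY => //; exact: measurable_prefix_set.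
apply: le_trans (prob_setU_le mu (mY _ _ _ m1) (mY _ _ _ m2)).
apply: prob_le; [|by apply: measurableU; exact: mY|].
  by apply: mY; exact: measurableU.
move=> u; rewrite !setY_def /= (pE q1) ?leq_maxl// (pE q2) ?leq_maxr//.
by have := pselect (B1 u); have := pselect (B2 u);
  have := pselect (D1 (prefix q1 u)); have := pselect (D2 (prefix q2 u)); tauto.
Qed.

Lemma approximableC B : approximable B -> approximable (~` B).
Proof.
move=> [mB aB]; split; first exact: measurableC.
move=> e /aB[q [D h]]; exists q, (~` D).
rewrite (_ : _ `+` _ = B `+` prefix q @^-1` D)//.
by apply/seteqP; split => u; rewrite !setY_def /=; have := pselect (B u);
  have := pselect (D (prefix q u)); tauto.
Qed.

Lemma approximable0 : approximable set0.
Proof.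
split=> // e e0; exists 0%N, set0.
by rewrite preimage_set0 setY0 measure0.
Qed.

(** By continuity of mu from below a finite partial union exhausts the whole up to [e / 2]; that
    finite union is in turn approximated up to [e / 2]. *)
Lemma approximable_bigcup (F : nat -> set Sig) :
  (forall n, approximable (F n)) -> approximable (\bigcup_n F n).
Proof.
move=> aF; have mF n := (aF n).1.
have mU : measurable (\bigcup_n F n) by exact: bigcupT_measurable.
split=> // e e0; have e20 : 0 < e / 2 by rewrite divr_gt0.
pose G n := \big[setU/set0]_(k < n.+1) F k.
have aG n : approximable (G n).
  rewrite /G; elim: n.+1 => {n}[|n IH]; first by rewrite big_ord0; exact: approximable0.
  by rewrite big_ord_recr/=; apply: approximableU.
have UG : \bigcup_n G n = \bigcup_n F n by exact: bigcup_bigsetU_bigcup.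
have cv : (mu \o G) @ \oo --> mu (\bigcup_n G n).
  apply: nondecreasing_cvg_mu; rewrite ?UG//.
    by move=> n; exact: (aG n).1.
  apply/nondecreasing_seqP => n; rewrite /G [X in (_ <= X)%O]big_ord_recr/=.
  by apply/subsetPset; exact: subsetUl.
have [n hn] : exists n, pr (\bigcup_n F n) - pr (G n) < e / 2.
  move: cv; rewrite UG -(@fineK _ (mu (\bigcup_n F n))) ?prob_fin_num//.
  move=> /fine_cvg /cvgrPdist_lt /(_ _ e20) [n _ /(_ n)] h.
  by exists n; apply: le_lt_trans (h (leqnn _)); rewrite ler_norm.
have [q [D hD]] := (aG n).2 _ e20.
have sG : G n `<=` \bigcup_n F n by rewrite -UG; exact: bigcup_sup.
have mG := (aG n).1.
exists q, D; rewrite [e]splitr.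
have mY B : measurable B -> measurable (B `+` prefix q @^-1` D).
  by move=> mB; apply: measurable_setY => //; exact: measurable_prefix_set.
have hD' : pr ((\bigcup_n F n) `\` G n) < e / 2.
  apply: le_lt_trans hn; rewrite measureD//; last first.
    by rewrite (le_lt_trans (probability_le1 _ _))// ltry.
  rewrite setIidr// fineB//; exact: prob_fin_num.
apply: le_lt_trans (ltrD hD' hD).
apply: le_trans (prob_setU_le mu (measurableD mU mG) (mY _ mG)).
apply: prob_le; [exact: mY|by apply: measurableU; [exact: measurableD|exact: mY]|].
move=> u; have := sG u; rewrite !setY_def /=; have := pselect (G n u); tauto.
Qed.

Lemma measurable_approximable (B : set Sig) : measurable B -> approximable B.
Proof.
rewrite measurable_cylinders; apply: smallest_sub; first split.
- exact: approximable0.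
- by move=> C aC; rewrite setTD; exact: approximableC.
- exact: approximable_bigcup.
move=> _ [[n [w ->]]|->]; last exact: approximable0.
split; first exact: measurable_cylinder.
move=> e e0; exists n, [set w].
by rewrite cylinderE setYK measure0.
Qed.

End approximation.

Section letters.
Context (N : nat).
Local Notation A := 'I_N.+1.
Implicit Types u : strings N.

(** Overwriting letter n of a string stands for appending a letter to its prefix of length n. *)
Definition set_letter u n (a : A) : strings N :=
  fun k => if k == n then a else u k.

Lemma prefix_set_letter u n m (a : A) : (m <= n)%N ->
  prefix m (set_letter u n a) = prefix m u.
Proof.
move=> mn; apply/prefixP => k km.
by rewrite /set_letter ltn_eqF// (leq_trans km mn).
Qed.

Lemma sum_children (V : nmodType) n u (F : n.+1.-tuple A -> V) :
  \sum_(w : n.+1.-tuple A | prefix n (extend w) == prefix n u) F w =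
  \sum_a F (prefix n.+1 (set_letter u n a)).
Proof.
rewrite (reindex_onto (fun a => prefix n.+1 (set_letter u n a))
  (fun w => tnth w ord_max)).
  apply: eq_bigl => a; rewrite tnth_mktuple /= {2}/set_letter eqxx eqxx andbT.
  apply/eqP/prefixP => k kn.
  have /prefixP -> := prefix_extend (prefix n.+1 (set_letter u n a)).
    by rewrite /set_letter ltn_eqF.
  exact: ltnW.
move=> w /eqP/prefixP e; apply: eq_from_tnth => i; rewrite tnth_mktuple.
rewrite /set_letter; case: eqP => [in_|/eqP in_].
  by congr (tnth w _); apply: val_inj.
rewrite -e; first by rewrite /extend -tnth_nth.
by rewrite ltn_neqAle in_ -ltnS ltn_ord.
Qed.

End letters.

(** * Probabilities with prescribed cylinder masses *)


Section unit_interval.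
Context (R : realType).

Let measurable_unit : measurable (`[0, 1[%classic : set (measurableTypeR R)).
Proof. exact: measurable_itv. Qed.

Definition unit_lebesgue : set (measurableTypeR R) -> \bar R :=
  mrestr lebesgue_measure measurable_unit.

HB.instance Definition _ := Measure.on unit_lebesgue.

Let unit_lebesgue_setT : unit_lebesgue [set: _] = 1%E.
Proof.
by rewrite /unit_lebesgue /mrestr setTI lebesgue_measure_itv/= lte_fin ltr01 oppr0 adde0.
Qed.

HB.instance Definition _ := Measure_isProbability.Build _ _ _ unit_lebesgue
  unit_lebesgue_setT.

Lemma unit_lebesgue_itv (B : set (measurableTypeR R)) (a b : R) : a <= b ->
  B `&` `[0, 1[ = `[a, b[%classic -> unit_lebesgue B = (b - a)%:E.
Proof.
move=> ab BE; rewrite /unit_lebesgue /mrestr BE lebesgue_measure_itv/= lte_fin.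
case: ltP => [|ba]; first by rewrite EFinB.
by rewrite (_ : b = a) ?subrr//; apply/eqP; rewrite eq_le ba ab.
Qed.

End unit_interval.


Section extension.
Context (N : nat) (R : realType).
Local Notation A := 'I_N.+1.
Local Notation Sig := (strings N).
Variable p : forall n, n.-tuple A -> R.
Hypothesis p_ge0 : forall n (w : n.-tuple A), 0 <= p w.
Hypothesis p0 : forall w : 0.-tuple A, p w = 1.
Hypothesis p_consistent : forall n (w : n.-tuple A),
  p w = \sum_(w' : n.+1.-tuple A | prefix n (extend w') == w) p w'.

Let P n (u : Sig) := p (prefix n u).

Let P_children n u : P n u = \sum_a P n.+1 (set_letter u n a).
Proof. by rewrite /P p_consistent sum_children. Qed.

(* Nested half-open intervals of lengths [p w] subdivide [0, 1[; the law of the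
   string coding a Lebesgue-random point has the prescribed masses. *)
Fixpoint left_end n (u : Sig) : R := if n is m.+1 then
  left_end m u + \sum_(a : A | (a < u m)%N) P m.+1 (set_letter u m a) else 0.

Let inside n u x := left_end n u <= x < left_end n u + P n u.

Let left_end_prefix n u v : prefix n u = prefix n v ->
  left_end n u = left_end n v.
Proof.
elim: n => //= n IH e; rewrite (IH (prefix_le (leqnSn n) e)).
have /prefixP e' := e; rewrite (e' n)//; congr (_ + _); apply: eq_bigr => a _.
congr (p _); apply/prefixP => k kn; rewrite /set_letter.
by case: eqP => // _; exact: e'.
Qed.

Let P_split n u (a : A) : P n u = \sum_(b : A | (b < a)%N) P n.+1 (set_letter u n b)
  + P n.+1 (set_letter u n a) + \sum_(b : A | (a < b)%N) P n.+1 (set_letter u n b).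
Proof.
rewrite P_children (bigID (fun b : A => (b < a)%N))/= -addrA; congr (_ + _).
rewrite (bigD1 a) ?ltnn//=; congr (_ + _); apply: eq_bigl => b.
by rewrite -leqNgt ltn_neqAle andbC eq_sym.
Qed.

Let set_letter_id n u : P n.+1 (set_letter u n (u n)) = P n.+1 u.
Proof.
by congr (p _); apply/prefixP => k _; rewrite /set_letter; case: eqP => // ->.
Qed.

Let nested n u : left_end n u <= left_end n.+1 u /\
  left_end n.+1 u + P n.+1 u <= left_end n u + P n u.
Proof.
rewrite /= lerDl -addrA lerD2l (P_split n u (u n)) set_letter_id lerDl.
by split; apply: sumr_ge0 => *; exact: p_ge0.
Qed.

Let within_unit n u : 0 <= left_end n u /\ left_end n u + P n u <= 1.
Proof.
elim: n => [|n [h1 h2]]; first by rewrite /= add0r /P p0.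
have [n1 n2] := nested n u; split; first exact: le_trans n1.
exact: le_trans n2 h2.
Qed.

(** Once the first n letters agree, the intervals of sibling words are ordered like their last
    letters and are disjoint, so x determines the next letter. *)
Let inside_unique n u v x : inside n u x -> inside n v x ->
  prefix n u = prefix n v.
Proof.
have inS m w : inside m.+1 w x -> inside m w x.
  have [n1 n2] := nested m w => /andP[h1 h2].
  by rewrite /inside (le_trans n1 h1) (lt_le_trans h2 n2).
elim: n => [|n IH] iu iv; first by apply/prefixP.
have e := IH (inS _ _ iu) (inS _ _ iv); have /prefixP e' := e.
suff en : u n = v n.
  apply/prefixP => k; rewrite ltnS leq_eqVlt => /predU1P[->//|]; exact: e'.
have letterE a : P n.+1 (set_letter u n a) = P n.+1 (set_letter v n a).
  congr (p _); apply/prefixP => k; rewrite ltnS leq_eqVlt /set_letter.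
  by case: eqP => //= _; exact: e'.
have lt_sep (s t : Sig) : (s n < t n)%N -> left_end n s = left_end n t ->
    (forall a, P n.+1 (set_letter s n a) = P n.+1 (set_letter t n a)) ->
    left_end n.+1 s + P n.+1 s <= left_end n.+1 t.
  move=> st lst Pst; rewrite /= lst -addrA lerD2l.
  rewrite [leRHS](bigID (fun b : A => (b < s n)%N))/=; apply: lerD.
    rewrite le_eqVlt; apply/orP; left; apply/eqP; apply: eq_big => [b|b _] //.
    by case: (ltnP b (s n)) => bs; rewrite ?andbF// andbT (ltn_trans bs st).
  rewrite (bigD1 (s n)) ?st ?ltnn//= -set_letter_id Pst lerDl.
  by apply: sumr_ge0 => *; exact: p_ge0.
move: iu iv => /andP[u1 u2] /andP[v1 v2].
have le := left_end_prefix e.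
apply/val_inj/eqP; rewrite eqn_leq.
apply/andP; split; rewrite leqNgt; apply/negP => h.
- have := lt_sep _ _ h (esym le) (fun a => esym (letterE a)).
  by rewrite leNgt => /negP; apply; apply: le_lt_trans u1 v2.
- have := lt_sep _ _ h le letterE.
  by rewrite leNgt => /negP; apply; apply: le_lt_trans v1 u2.
Qed.

Let next_letter n u x : inside n u x ->
  exists a, inside n.+1 (set_letter u n a) x.
Proof.
move=> /andP[x1 x2].
pose S k := left_end n u + \sum_(a : A | (a < k)%N) P n.+1 (set_letter u n a).
have ex : exists k, x < S k.
  exists N.+1; rewrite /S (eq_bigl xpredT) -?P_children// => a.
  by rewrite ltn_ord.
(* [S k] is the right end of the intervals of the first k letters. If j+1 is the least index with x
   < [S j.+1], then x lies in the interval of letter j; index 0 is excluded because [S 0] is the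
   left end. *)
case: (ex_minnP ex) => -[|j] xS min.
  by move: xS; rewrite /S big_pred0_eq addr0 ltNge x1.
have Sx : S j <= x by rewrite leNgt; apply/negP => /min; rewrite ltnn.
have jN : (j < N.+1)%N.
  rewrite ltnNge; apply/negP => Nj; move: Sx; rewrite leNgt => /negP; apply.
  rewrite /S (eq_bigl xpredT) -?P_children// => a.
  by rewrite (leq_trans (ltn_ord a)).
pose a := Ordinal jN; exists a.
have le : left_end n.+1 (set_letter u n a) = S j.
  rewrite /= (_ : set_letter u n a n = a); last by rewrite /set_letter eqxx.
  rewrite (_ : left_end n (set_letter u n a) = left_end n u); last first.
    apply: left_end_prefix; apply/prefixP => k kn.
    by rewrite /set_letter ltn_eqF.
  congr (_ + _); apply: eq_bigr => b _; congr (p _); apply/prefixP => k _.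
  by rewrite /set_letter; case: eqP.
rewrite /inside le Sx /=; apply: lt_le_trans xS _.
rewrite /S -addrA lerD2l (bigD1 a)//= addrC lerD2r le_eqVlt.
apply/orP; left; apply/eqP; apply: eq_bigl => b.
by rewrite ltnS -val_eqE/= ltn_neqAle andbC.
Qed.

Let inside_path x : 0 <= x < 1 -> exists u, forall n, inside n u x.
Proof.
move=> x01.
have /choice[f fP] (c : nat * Sig) : exists v : Sig, inside c.1 c.2 x ->
    inside c.1.+1 v x /\ prefix c.1 v = prefix c.1 c.2.
  have [/next_letter[a ia]|?] := boolP (inside c.1 c.2 x); last by exists c.2.
  exists (set_letter c.2 c.1 a) => _; split => //; apply/prefixP => k kn.
  by rewrite /set_letter ltn_eqF.
pose s := fix s n := if n is m.+1 then f (m, s m) else (fun=> ord0 : A) : Sig.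
have sP n : inside n (s n) x.
  elim: n => [|n IH]; first by rewrite /inside/= add0r /P p0.
  by have [] := fP (n, s n) IH.
have sE n m : (n <= m)%N -> prefix n (s m) = prefix n (s n).
  move=> /subnK <-; elim: (m - n)%N => // k IH; rewrite -IH addSn.
  have [_ /= e] := fP (k + n, s (k + n))%N (sP _).
  by apply: (prefix_le (leq_addl k n)).
(* The diagonal string: letter n no longer changes from [s n.+1] on. *)
exists (fun n => s n.+1 n) => n.
have e : prefix n (fun k => s k.+1 k : A) = prefix n (s n).
  apply/prefixP => k kn; have /prefixP -> // := sE k.+1 n kn.
by rewrite /inside (left_end_prefix e) /P e; exact: sP.
Qed.

Lemma probability_extension :
  exists mu : probability Sig R, forall n (w : n.-tuple A), mass mu w = p w.
Proof.
(* Outside the unit interval T is constant, so there the preimage of a cylinder is everything or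
   nothing, which keeps T measurable. *)
have /choice[T TP] (x : measurableTypeR R) : exists u : Sig,
    (0 <= x < 1 -> forall n, inside n u x) /\
    (~~ (0 <= x < 1) -> u = (fun=> ord0)).
  have [x01|nx] := boolP (0 <= x < 1).
    by have [u iu] := inside_path x01; exists u; split => //; rewrite x01.
  by exists (fun=> ord0).
pose J n (w : n.-tuple A) := `[left_end n (extend w),
  left_end n (extend w) + p w[%classic.
have PE n (w : n.-tuple A) : P n (extend w) = p w.
  by rewrite /P prefix_extend.
have JT n (w : n.-tuple A) x : 0 <= x < 1 ->
    prefix n (T x) = w <-> J n w x.
  move=> x01; rewrite /J /= in_itv/= -PE -/(inside n (extend w) x).
  have [/(_ x01 n) iT _] := TP x; split => [e|ix].
    move: iT; rewrite /inside /P e prefix_extend.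
    by rewrite (@left_end_prefix _ _ (extend w))// prefix_extend.
  by rewrite (inside_unique iT ix) prefix_extend.
have J01 n (w : n.-tuple A) x : J n w x -> 0 <= x < 1.
  have [l0 l1] := within_unit n (extend w); rewrite /J /= in_itv/= -PE.
  by move=> /andP[h1 h2]; rewrite (le_trans l0 h1) (lt_le_trans h2 l1).
have TI n (w : n.-tuple A) :
    T @^-1` (prefix n @^-1` [set w]) `&` `[0, 1[ = J n w.
  apply/seteqP; split=> x /=; rewrite in_itv/=.
    by move=> [e x01]; apply/JT.
  by move=> Jx; have x01 := J01 _ _ _ Jx; split=> //; apply/JT.
have mT : measurable_fun setT T.
  apply: (measurability _ (measurable_cylinders N)).
  move=> _ [_ [[n [w ->]]|->] <-]; rewrite setTI; last by rewrite preimage_set0.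
  rewrite cylinderE -[X in measurable X](setUIDK _ `[0, 1[%classic) TI.
  apply: measurableU; first exact: measurable_itv.
  have [e|ne] := eqVneq (prefix n (fun=> ord0 : A)) w.
    rewrite (_ : _ `\` _ = ~` `[0, 1[%classic).
      by apply: measurableC; exact: measurable_itv.
    apply/seteqP; split=> x /=; rewrite in_itv/=; first by case.
    by move=> nx; split=> //; rewrite (TP x).2//; exact/negP.
  rewrite (_ : _ `\` _ = set0)//; apply/seteqP; split=> // x /=.
  rewrite in_itv/= => -[e /negP nx]; move: ne; rewrite -e (TP x).2//.
  by rewrite eqxx.
have [mu muE] := pushforward_probability (@unit_lebesgue R) mT.
exists mu => n w; rewrite /mass /law muE.
have ab : left_end n (extend w) <= left_end n (extend w) + p w by rewrite lerDl.
have -> := congr1 fine (unit_lebesgue_itv ab (TI n w)).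
by rewrite /= addrAC subrr add0r.
Qed.

End extension.

(** * The upper bound *)


Section windows.
Context (N : nat) (R : realType).
Local Notation A := 'I_N.+1.
Local Notation Sig := (strings N).
Local Notation sft := (@string_shift N).
Implicit Types (u v : Sig).

Lemma window_prefix q k n u v : (k + q <= n)%N -> prefix n u = prefix n v ->
  prefix q (iter k sft u) = prefix q (iter k sft v).
Proof.
move=> kqn /prefixP e; apply/prefixP => j jq; rewrite !iter_shiftE.
by apply: e; apply: leq_trans kqn; rewrite ltn_add2l.
Qed.

Lemma iter_shift_set_letter u n q a :
  iter n sft (set_letter u (n + q) a) = set_letter (iter n sft u) q a.
Proof.
by apply/funext => j; rewrite iter_shiftE /set_letter eqn_add2l iter_shiftE.
Qed.

Section markov_weight.
Variables (q : nat) (Q : q.+1.-tuple A -> R).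
Hypothesis Q_ge0 : forall w, 0 <= Q w.
Hypothesis Q_le1 : forall u, \sum_a Q (prefix q.+1 (set_letter u q a)) <= 1.

(** [Q w] is read as the probability of the last letter of w given its first q letters. This is then
    the weight of the n letters of u that follow the first q; those carry no weight of their own. *)
Definition markov_weight n u := \prod_(k < n) Q (prefix q.+1 (iter k sft u)).

Lemma markov_weight_prefix n u v : prefix (n + q) u = prefix (n + q) v ->
  markov_weight n u = markov_weight n v.
Proof.
move=> e; apply: eq_bigr => k _; congr Q; apply: (window_prefix _ e).
by rewrite addnS -addSn leq_add2r.
Qed.

(** Summing out the last letter does not increase the total, by [Q_le1]; what remains at the end is
    the number of initial words of length q. *)
Lemma sum_markov_weight n :
  \sum_(i : (n + q).-tuple A) markov_weight n (extend i) <= (N.+1 ^ q)%:R.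
Proof.
elim: n => [|n IH].
  rewrite (eq_bigr (fun=> 1)) => [|i _]; last by rewrite /markov_weight big_ord0.
  by rewrite sumr_const card_tuple card_ord.
apply: le_trans IH.
rewrite (partition_big (fun i : (n + q).+1.-tuple A => prefix (n + q) (extend i))
  xpredT)//=.
apply: ler_sum => v _; rewrite -[v in leLHS]prefix_extend sum_children.
under eq_bigr => a _.
  rewrite (@markov_weight_prefix _ _ (set_letter (extend v) (n + q) a)); last first.
    by rewrite prefix_extend.
  rewrite /markov_weight big_ord_recr/= -/(markov_weight n _).
  rewrite (@markov_weight_prefix _ _ (extend v)) ?prefix_set_letter//.
  rewrite iter_shift_set_letter.
  over.
rewrite -mulr_sumr ler_piMr//.
by apply: prodr_ge0 => k _.
Qed.

Lemma sum_markov_weight_sub n : (q <= n)%N ->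
  \sum_(i : n.-tuple A) markov_weight (n - q) (extend i) <= (N.+1 ^ q)%:R.
Proof.
move=> qn; have e := subnK qn; move: (n - q)%N e => m e; subst n.
exact: sum_markov_weight.
Qed.

End markov_weight.

Lemma empirical_law n u (I : finType) (X : Sig -> I) a : (0 < n)%N ->
  law (empirical R n u) X a = n%:R^-1 * \sum_(k < n) (X (iter k sft u) == a)%:R.
Proof.
move=> n0; rewrite /law /= /empirical /mscale /= prednK// /msum.
rewrite (eq_bigr (fun k : 'I_n => ((X (iter k sft u) == a)%:R)%:E)) => [|k _].
  by rewrite sumEFin.
by rewrite /= diracE; case: eqP => e; [rewrite mem_set|rewrite memNset].
Qed.

Lemma empirical_expect n u (I : finType) (X : Sig -> I) (g : I -> R) :
  (0 < n)%N ->
  \sum_a law (empirical R n u) X a * g a =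
  n%:R^-1 * \sum_(k < n) g (X (iter k sft u)).
Proof.
move=> n0; under eq_bigr => a _ do rewrite empirical_law// -mulrA mulr_suml.
rewrite -mulr_sumr exchange_big/=; congr (_ * _); apply: eq_bigr => k _.
rewrite (bigD1 (X (iter k sft u)))//= eqxx mul1r big1 ?addr0// => a.
by rewrite eq_sym => /negPf ->; rewrite mul0r.
Qed.

(** Shifting an orbit segment drops its first point and adds one at its end; the difference
    telescopes to two indicators. *)
Lemma empirical_almost_invariant n u (I : finType) (X : Sig -> I) a :
  (0 < n)%N ->
  `|law (empirical R n u) (X \o sft) a - law (empirical R n u) X a| <= n%:R^-1.
Proof.
case: n => // n _; rewrite !empirical_law// -mulrBr normrM ger0_norm//.
pose F k : R := (X (iter k sft u) == a)%:R.
rewrite -sumrB -(big_mkord xpredT (fun k => F k.+1 - F k)) telescope_sumr//.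
by rewrite ler_piMr// /F; do 2 case: eqP => _;
  rewrite ?subrr ?subr0 ?sub0r ?normrN ?normr0 ?normr1.
Qed.

Lemma birkhoff_approx n u q (f : Sig -> R) e : (0 < n)%N ->
  (forall u v, prefix q u = prefix q v -> `|f u - f v| <= e) ->
  `|\sum_(k < n) f (iter k sft u) -
    n%:R * \sum_(w : q.-tuple A) mass (empirical R n u) w * f (extend w)|
  <= n%:R * e.
Proof.
move=> n0 osc; rewrite empirical_expect// mulrA divff ?pnatr_eq0 -?lt0n// mul1r.
rewrite -sumrB; apply: le_trans (ler_norm_sum _ _ _) _.
rewrite mulr_natl -[n in leRHS]card_ord -sumr_const; apply: ler_sum => k _.
by apply: osc; rewrite prefix_extend.
Qed.

End windows.


Lemma pconvE d (T : measurableType d) (R : realType) (t : {i01 R})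
    (mu nu : probability T R) B : measurable B ->
  fine (pconv t mu nu B) =
  t%:num * fine (mu B) + (1 - t%:num) * fine (nu B).
Proof.
move=> mB; rewrite /pconv measure_addE.
rewrite [LHS](_ : _ =
  fine ((t%:num)%:E * mu B + (1 - t%:num)%:E * nu B)%E)//.
by rewrite fineD ?fineM ?fin_numM ?prob_fin_num.
Qed.

(** The mixture is assembled from [pconv] alone, so any property stable under two-point combinations
    survives. Terms of weight zero are skipped, because K is known only where the weight is
    positive. *)
Lemma finite_mixture d (T : measurableType d) (R : realType)
    (K : probability T R -> Prop) (I : Type) (r : seq I) (w : I -> R)
    (m : I -> probability T R) :
  (forall t mu nu, K mu -> K nu -> K (pconv t mu nu)) ->
  (forall i, 0 <= w i) -> (forall i, 0 < w i -> K (m i)) ->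
  0 < \sum_(i <- r) w i ->
  exists2 nu, K nu & forall B, measurable B ->
    fine (nu B) * \sum_(i <- r) w i = \sum_(i <- r) w i * fine (m i B).
Proof.
move=> Kc w0 wK; elim: r => [|i r IH]; first by rewrite big_nil ltxx.
rewrite big_cons; set W := \sum_(j <- r) w j.
have W0 : 0 <= W by exact: sumr_ge0.
have [wi0 _|wi0] := ltrP 0 (w i); last first.
  have -> : w i = 0 by apply/le_anti; rewrite wi0 w0.
  rewrite add0r => /IH[nu Knu nuE]; exists nu => // B mB.
  rewrite nuE// big_cons [w i](_ : _ = 0) ?mul0r ?add0r//.
  by apply/le_anti; rewrite wi0 w0.
have Ki := wK _ wi0.
have [Wp|WN] := ltrP 0 W; last first.
  have We : W = 0 by apply/le_anti; rewrite WN.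
  exists (m i) => // B mB; rewrite big_cons We addr0 mulrC.
  rewrite [X in _ = _ + X](_ : _ = 0) ?addr0//.
  apply/le_anti/andP; split.
    rewrite -[leRHS]We /W; apply: ler_sum => j _; rewrite ler_piMr//.
    by rewrite -lee_fin fineK ?prob_fin_num// probability_le1.
  by apply: sumr_ge0 => j _; rewrite mulr_ge0// fine_ge0.
have [nu Knu nuE] := IH Wp.
have S0 : 0 < w i + W by rewrite addr_gt0.
have t0 : 0 <= w i / (w i + W) by rewrite divr_ge0// ltW.
have t1 : w i / (w i + W) <= 1 by rewrite ler_pdivrMr// mul1r lerDl.
exists (pconv (Itv01 t0 t1) (m i) nu); first exact: Kc.
move=> B mB; rewrite big_cons -nuE// pconvE//=.
by rewrite -/W; field; rewrite gt_eqF.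
Qed.


Lemma ln_prod (R : realType) (I : Type) (r : seq I) (F : I -> R) :
  (forall i, 0 < F i) -> ln (\prod_(i <- r) F i) = \sum_(i <- r) ln (F i).
Proof.
move=> F0; elim: r => [|i r IH]; first by rewrite !big_nil ln1.
by rewrite !big_cons lnM ?posrE ?F0 ?IH//; apply: prodr_gt0.
Qed.

Section upper_bound.
Context (R : realType) (N : nat) (X : normedModType R).
Local Notation A := 'I_N.+1.
Local Notation Sig := (strings N).
Local Notation sft := (@string_shift N).
Variables (U : probability Sig R -> X) (C : set X) (phi : Sig -> R).
Hypothesis phi_cont : continuous phi.
Hypothesis convex_UC : forall t mu nu, C (U mu) -> C (U nu) ->
  C (U (pconv t mu nu)).
Local Notation Z := (partition_function U C phi).

Definition birkhoff n u : R := \sum_(k < n) phi (iter k sft u).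

Definition admissible n (i : n.-tuple A) : Prop :=
  [set U (empirical R n u) | u in cylinder i] `<=` C.

Definition cylinder_sup n (i : n.-tuple A) : R :=
  sup [set expR (birkhoff n u) | u in cylinder i].

Lemma birkhoff_le n u M : (forall v, `|phi v| <= M) ->
  `|birkhoff n u| <= n%:R * M.
Proof.
move=> hM; apply: le_trans (ler_norm_sum _ _ _) _.
by rewrite mulr_natl -[n in leRHS]card_ord -sumr_const; apply: ler_sum.
Qed.

Lemma has_sup_cylinder n (i : n.-tuple A) :
  has_sup [set expR (birkhoff n u) | u in cylinder i].
Proof.
have [M _ hM] := continuous_bounded phi_cont; split.
  exists (expR (birkhoff n (extend i))); exists (extend i) => //.
  by rewrite cylinderE /= prefix_extend.
exists (expR (n%:R * M)) => _ [u _ <-]; rewrite ler_expR.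
exact: le_trans (ler_norm _) (birkhoff_le n u hM).
Qed.

Lemma cylinder_sup_ge n (i : n.-tuple A) u : prefix n u = i ->
  expR (birkhoff n u) <= cylinder_sup i.
Proof.
move=> e; apply: sup_upper_bound; first exact: has_sup_cylinder.
by exists u => //; rewrite cylinderE.
Qed.

Lemma cylinder_sup_gt0 n (i : n.-tuple A) : 0 < cylinder_sup i.
Proof.
apply: lt_le_trans (expR_gt0 _) (cylinder_sup_ge (prefix_extend i)).
Qed.

(** The factor 2 costs [ln 2] in the logarithm, which division by n makes negligible. *)
Lemma cylinder_sup_near n (i : n.-tuple A) : exists u, prefix n u = i /\
  cylinder_sup i <= 2 * expR (birkhoff n u).
Proof.
have e0 : 0 < cylinder_sup i / 2 by rewrite divr_gt0// cylinder_sup_gt0.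
have [_ [u iu <-]] := sup_adherent e0 (has_sup_cylinder i).
rewrite -/(cylinder_sup i) => h; exists u; split.
  by move: iu; rewrite cylinderE.
rewrite mulrC -ler_pdivrMr//; apply: ltW; apply: le_lt_trans h.
by rewrite {2}[cylinder_sup i]splitr addrK.
Qed.

Lemma partition_functionE n : Z n =
  \sum_(i : n.-tuple A) if `[< admissible i >] then cylinder_sup i else 0.
Proof. by rewrite /partition_function big_mkcond. Qed.

(** nu is the mixture of the empirical measures of near-optimal points. It does not depend on q, Q,
    p and e in the last clause: the kernel may be chosen after a limit of such nu has been taken. *)
Lemma partition_measure n : (0 < n)%N -> 0 < Z n -> exists nu : probability Sig R,
  [/\ C (U nu),
   forall (I : finType) (Y : Sig -> I) a, measurable_label Y ->
     `|law nu (Y \o sft) a - law nu Y a| <= n%:R^-1 &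
   forall q (Q : q.+1.-tuple A -> R) p e, (q <= n)%N ->
     (forall w, 0 < Q w <= 1) ->
     (forall u, \sum_a Q (prefix q.+1 (set_letter u q a)) <= 1) ->
     (forall u v, prefix p u = prefix p v -> `|phi u - phi v| <= e) ->
     ln (Z n) <= ln 2 + q%:R * ln (N.+1%:R : R) +
       n%:R * (\sum_w mass nu w * - ln (Q w) +
         \sum_(w : p.-tuple A) mass nu w * phi (extend w) + e)].
Proof.
move=> n0 Z0; have nR : 0 < n%:R :> R by rewrite ltr0n.
have /choice[u uP] := @cylinder_sup_near n.
pose w i := if `[< admissible i >] then expR (birkhoff n (u i)) else 0.
have w0 i : 0 <= w i by rewrite /w; case: ifP; rewrite ?expR_ge0.
pose W := \sum_i w i.
have ZW : Z n <= 2 * W.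
  rewrite partition_functionE mulr_sumr; apply: ler_sum => i _.
  by rewrite /w; case: ifP => _; rewrite ?mulr0// (uP i).2.
have W0 : 0 < W by rewrite -(pmulr_rgt0 W (ltr0n R 2)) (lt_le_trans Z0 ZW).
have wK i : 0 < w i -> C (U (empirical R n (u i))).
  rewrite /w; case: asboolP => [adm _|_]; last by rewrite ltxx.
  by apply: adm; exists (u i) => //; rewrite cylinderE /= (uP i).1.
have [nu Cnu nuE] := finite_mixture convex_UC w0 wK W0.
have lawE (I : finType) (Y : Sig -> I) a : measurable_label Y ->
    law nu Y a * W = \sum_i w i * law (empirical R n (u i)) Y a.
  by move=> mY; rewrite /law nuE//; exact: mY.
have p0 i : 0 <= w i / W by rewrite divr_ge0// ltW.
have expE (I : finType) (Y : Sig -> I) (g : I -> R) : measurable_label Y ->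
    \sum_i w i / W * (\sum_a law (empirical R n (u i)) Y a * g a) =
    \sum_a law nu Y a * g a.
  move=> mY; under eq_bigr do rewrite mulr_sumr.
  rewrite exchange_big/=; apply: eq_bigr => a _.
  rewrite -[law nu Y a](mulfK (lt0r_neq0 W0)) lawE// !mulr_suml.
  by apply: eq_bigr => i _; ring.
exists nu; split => //.
- move=> I Y a mY; have mYs := measurable_label_shift 1 mY.
  rewrite -(ler_pM2r W0) -[X in _ * X <= _](gtr0_norm W0) -normrM mulrBl.
  rewrite (lawE _ _ _ mYs) (lawE _ _ _ mY) -sumrB.
  apply: le_trans (ler_norm_sum _ _ _) _; rewrite mulr_sumr.
  apply: ler_sum => i _; rewrite -mulrBr normrM (ger0_norm (w0 i)) mulrC.
  by rewrite ler_wpM2r//; exact: empirical_almost_invariant.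
move=> q Q p e qn Q01 Q1 osc.
have Q0 v : 0 < Q v by have /andP[] := Q01 v.
pose c : R := (N.+1 ^ q)%:R.
have c0 : 0 < c by rewrite ltr0n expn_gt0.
(* Only the first n - q windows lie inside a word of length n; division by the number of words of
   length q brings the total of r down to at most 1. *)
pose r (i : n.-tuple A) := markov_weight Q (n - q) (extend i) / c.
have mw0 v : 0 < markov_weight Q (n - q) v by apply: prodr_gt0.
have r0 i : 0 < r i by rewrite divr_gt0.
have sp : \sum_i w i / W = 1 by rewrite -mulr_suml divff// gt_eqF.
have := @gibbs R _ (fun i => w i / W) r p0 (fun i => ltW (r0 i)) (fun i _ => r0 i).
rewrite sp -mulr_suml ler_pdivrMr// mul1r.
move=> /(_ (sum_markov_weight_sub (fun v => ltW (Q0 v)) Q1 qn)) G.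
(* The equality case of the Gibbs principle: where w i > 0, [ln (w i / W)] is the Birkhoff sum minus
   [ln W]. *)
have lnW : ln W = \sum_i w i / W * birkhoff n (u i) -
    \sum_i w i / W * ln (w i / W).
  rewrite -sumrB -[LHS]mul1r -sp mulr_suml; apply: eq_bigr => i _.
  rewrite /w; case: ifP => _; last by rewrite !mul0r subrr.
  by rewrite ln_div ?posrE ?expR_gt0// expRK; ring.
have lnr i : - ln (r i) <= q%:R * ln (N.+1%:R : R) +
    n%:R * \sum_v mass (empirical R n (u i)) v * - ln (Q v).
  rewrite /mass empirical_expect// mulrA divff ?gt_eqF// mul1r.
  rewrite /r ln_div ?posrE// opprB /c natrX lnXn// mulr_natl lerD2l.
  rewrite /markov_weight ln_prod// -sumrN.
  (* The empirical measure counts all n windows. Those overhanging the word are not seen by r, but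
     their terms [- ln (Q _)] are nonnegative as Q is at most 1, so adding them is harmless. *)
  rewrite [leRHS](bigID (fun k : 'I_n => (k < n - q)%N))/= -[leLHS]addr0 lerD//.
    rewrite (big_ord_widen_cond n xpredT
      (fun k => - ln (Q (prefix q.+1 (iter k sft (extend i))))) (leq_subr q n))/=.
    apply: ler_sum => k kn; rewrite le_eqVlt; apply/orP; left; apply/eqP.
    congr (- ln (Q _)); apply: (@window_prefix _ _ _ n).
      by rewrite addnS -addSn addnC -leq_subRL// addnC.
    by rewrite prefix_extend (uP i).1.
  apply: sumr_ge0 => k _; rewrite oppr_ge0 ln_le0//.
  by have /andP[] := Q01 (prefix q.+1 (iter k sft (u i))).
have fB i : birkhoff n (u i) <= n%:R *
    (\sum_(v : p.-tuple A) mass (empirical R n (u i)) v * phi (extend v) + e).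
  have := @birkhoff_approx N R n (u i) p phi e n0 osc.
  by rewrite mulrDr -lerBlDl => /(le_trans (ler_norm _)).
apply: (@le_trans _ _ (ln (2 * W))).
  by rewrite ler_ln ?posrE// mulr_gt0.
rewrite lnM ?posrE// -addrA lerD2l lnW.
apply: (@le_trans _ _ (\sum_i w i / W * birkhoff n (u i) -
    \sum_i w i / W * ln (r i))).
  by rewrite lerD2l.
rewrite -sumrB.
apply: (@le_trans _ _ (\sum_i w i / W * (q%:R * ln (N.+1%:R : R) +
    n%:R * (\sum_v mass (empirical R n (u i)) v * - ln (Q v)) + n%:R *
    (\sum_(v : p.-tuple A) mass (empirical R n (u i)) v * phi (extend v) + e)))).
  apply: ler_sum => i _; rewrite -mulrBr ler_wpM2l// addrC.
  exact: lerD (lnr i) (fB i).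
rewrite -(expE _ _ _ (@measurable_prefix N q.+1)).
rewrite -(expE _ _ _ (@measurable_prefix N p)).
rewrite -[q%:R * _ in leRHS]mul1r -[e in leRHS]mul1r -sp !mulr_suml.
rewrite -!big_split/= mulr_sumr -big_split/=.
by apply: ler_sum => i _; rewrite le_eqVlt; apply/orP; left; apply/eqP; ring.
Qed.

End upper_bound.


(** * Limit measures along an ultrafilter *)

Lemma cvg_sumr (R : realType) (T : Type) (F : set_system T) (FF : Filter F)
    (I : Type) (r : seq I) (P : pred I) (f : I -> T -> R) (l : I -> R) :
  (forall i, f i @ F --> l i) ->
  (fun x => \sum_(i <- r | P i) f i x) @ F --> \sum_(i <- r | P i) l i.
Proof.
move=> fl; elim: r => [|i r IH].
  by under eq_fun do rewrite big_nil; rewrite big_nil; exact: cvg_cst.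
under eq_fun do rewrite big_cons; rewrite big_cons.
by case: (P i) => //; apply: cvgD.
Qed.

(** Compactness provides a cluster point, and an ultrafilter converges to each of its cluster
    points. A single ultrafilter serves all words at once, in place of a diagonal extraction. *)
Lemma ultra_bounded_cvg (R : realType) (F : set_system nat) (UF : UltraFilter F)
    (f : nat -> R) (M : R) :
  (forall n, `|f n| <= M) -> cvg (f @ F).
Proof.
move=> fM; have FF : F (f @^-1` `[- M, M]%classic).
  by apply: filterE => n /=; have := fM n; rewrite in_itv/= ler_norml.
have [l [_ cl]] := segment_compact (fmap_proper_filter f _) FF.
apply/cvg_ex; exists l => B lB /=.
have [//|FnB] := in_ultra_setVsetC (f @^-1` B) UF.
by have [x [nBx Bx]] := cl (~` B) B FnB lB.
Qed.

(* [Q] is the conditional law of the next letter, with [d] added to every mass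
   so that it is positive. *)
Lemma smoothed_kernel (R : realType) (N : nat) (mu : probability (strings N) R)
    q (e : R) : 0 < e ->
  exists Q : q.+1.-tuple 'I_N.+1 -> R, [/\ forall w, 0 < Q w <= 1,
    forall u, \sum_a Q (prefix q.+1 (set_letter u q a)) <= 1 &
    \sum_w mass mu w * - ln (Q w) <= partition_entropy mu (@prefix N q.+1) -
      partition_entropy mu (@prefix N q) + e].
Proof.
move=> e0.
pose K : R := (#|{: q.-tuple 'I_N.+1}|.+1)%:R.
have K0 : 0 < K by rewrite ltr0n.
(* Each of the N+1 continuations of a word receives d, so the word itself receives M = (N+1) d and
   the kernel stays stochastic; M summed over all words of length q stays below e. *)
pose M := e / K; have M0 : 0 < M by rewrite divr_gt0.
pose d := M / N.+1%:R; have d0 : 0 < d by rewrite divr_gt0.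
have dM : d <= M by rewrite ler_pdivrMr// ler_peMr ?ler1n// ltW.
pose tr (w : q.+1.-tuple 'I_N.+1) := prefix q (extend w).
have trE : tr \o @prefix N q.+1 = @prefix N q.
  apply/funext => u /=; apply: (prefix_le (leqnSn q)).
  by rewrite prefix_extend.
have mp n := @measurable_prefix N n.
have b0 v : 0 < mass mu v + M by rewrite ltr_wpDl// mass_ge0.
have a0 n (w : n.-tuple 'I_N.+1) : 0 < mass mu w + d.
  by rewrite ltr_wpDl// mass_ge0.
pose Q w := (mass mu w + d) / (mass mu (tr w) + M).
exists Q; split.
- move=> w; rewrite divr_gt0//= ler_pdivrMr// mul1r lerD//.
  by rewrite /mass -[@prefix N q]trE; exact: (law_le_comp mu tr w (mp q.+1)).
- move=> u; have trS a : tr (prefix q.+1 (set_letter u q a)) = prefix q u.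
    by rewrite -[tr _]/((tr \o @prefix N q.+1) _) trE prefix_set_letter.
  under eq_bigr do rewrite /Q trS; rewrite -mulr_suml big_split/=.
  rewrite -sum_children -mass_prefix// sumr_const card_ord.
  by rewrite -[d *+ _]mulr_natr divfK// divff// gt_eqF.
have -> : \sum_w mass mu w * - ln (Q w) =
    \sum_w mass mu w * ln (mass mu (tr w) + M) -
    \sum_(w : q.+1.-tuple 'I_N.+1) mass mu w * ln (mass mu w + d).
  rewrite -sumrB; apply: eq_bigr => w _; rewrite /Q ln_div ?posrE//.
  by ring.
have -> : \sum_w mass mu w * ln (mass mu (tr w) + M) =
    \sum_(v : q.-tuple 'I_N.+1) mass mu v * ln (mass mu v + M).
  transitivity (\sum_v law mu (tr \o @prefix N q.+1) v * ln (mass mu v + M)).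
    exact: law_expect (mp q.+1).
  by rewrite trE.
have HE n : partition_entropy mu (@prefix N n) =
  - \sum_(w : n.-tuple 'I_N.+1) mass mu w * ln (mass mu w) by [].
rewrite !HE opprK addrC -[leRHS]addrA; apply: lerD.
  rewrite lerN2; apply: ler_sum => w _.
  have := mass_ge0 mu w; rewrite le_eqVlt => /predU1P[<-|w0].
    by rewrite !mul0r.
  rewrite ler_wpM2l ?mass_ge0// ler_ln ?posrE ?a0//.
  by rewrite lerDl ltW.
(* [ln x <= x - 1] at x = (p + M) / p gives p ln (p + M) <= p ln p + M: every word costs at most M,
   however small its mass p. *)
apply: (@le_trans _ _ (\sum_(v : q.-tuple 'I_N.+1) (mass mu v * ln (mass mu v) + M))).
  apply: ler_sum => v _; have := mass_ge0 mu v; rewrite le_eqVlt => /predU1P[<-|v0].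
    by rewrite !mul0r add0r ltW.
  rewrite -lerBlDl -mulrBr -ln_div ?posrE//.
  have := ln_le_sub1 (divr_gt0 (b0 _ v) v0) => /(ler_wpM2l (mass_ge0 mu v)).
  move=> /le_trans; apply; rewrite le_eqVlt; apply/orP; left; apply/eqP.
  by field; rewrite gt_eqF.
rewrite big_split/= lerD2l sumr_const -[leLHS]mulr_natr /M mulrAC.
by rewrite ler_pdivrMr// ler_pM2l// ler_nat.
Qed.

Section upper_limit.
Context (R : realType) (N : nat) (X : normedModType R).
Local Notation A := 'I_N.+1.
Local Notation Sig := (strings N).
Local Notation sft := (@string_shift N).
Variables (U : probability Sig R -> X) (C : set X) (phi : Sig -> R).
Hypothesis phi_cont : continuous phi.
Hypothesis convex_UC : forall t mu nu, C (U mu) -> C (U nu) ->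
  C (U (pconv t mu nu)).
Hypothesis closed_UC : forall mu : probability Sig R,
  (forall q d, 0 < d -> exists nu, close_prefix mu q d nu /\ C (U nu)) -> C (U mu).
Local Notation Z := (partition_function U C phi).

(** The bound is assumed for infinitely many n only. If the conclusion fails for some c, then c is
    an upper bound for all large n with [0 < Z n], which is how the limsup is controlled. *)
Lemma upper_measure (c : R) :
  (forall m, exists n, [/\ (m <= n)%N, 0 < Z n & c <= n%:R^-1 * ln (Z n)]) ->
  exists mu : probability Sig R, [/\ shift_invariant mu, C (U mu) &
    forall q, c <= partition_entropy mu (@prefix N q.+1) -
      partition_entropy mu (@prefix N q) + \int[mu]_x phi x].
Proof.
move=> freq.
have /choice[n_ nP] m := freq m.+1.
have n0 k : (0 < n_ k)%N by have [h _ _] := nP k; exact: leq_trans h.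
have /choice[nu nuP] k := partition_measure phi_cont convex_UC (n0 k)
  (let: And3 _ h _ := nP k in h).
have [F [UF sF]] := ultraFilterLemma eventually_filter.
have FF : ProperFilter F := @ultra_proper _ F UF.
have inv0 : (fun k => (n_ k)%:R^-1 : R) @ F --> 0.
  apply: (cvg_trans (G := (fun k => (n_ k)%:R^-1 : R) @ \oo)).
    by move=> B; exact: sF.
  apply: (@squeeze_cvgr _ _ _ _ (fun=> 0) (@harmonic R)).
  - near=> k; rewrite invr_ge0 ler0n/= lef_pV2 ?posrE ?ltr0n//.
    by rewrite ler_nat; have [] := nP k.
  - exact: cvg_cst.
  - exact: cvg_harmonic.
pose p n (w : n.-tuple A) := lim ((fun k => mass (nu k) w) @ F).
have pcv n (w : n.-tuple A) : (fun k => mass (nu k) w) @ F --> p n w.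
  apply: (@ultra_bounded_cvg _ _ _ _ 1) => // k.
  by rewrite ger0_norm ?mass_ge0//; apply: law_le1; exact: measurable_prefix.
have p_ge0 n (w : n.-tuple A) : 0 <= p n w.
  by apply: cvgr_to_ge (pcv n w) _; apply: nearW => k; exact: mass_ge0.
have p0 (w : 0.-tuple A) : p 0%N w = 1.
  rewrite /p (_ : (fun k => _) = fun=> 1); first exact: lim_cst.
  apply/funext => k; rewrite -(mass_sum1 (nu k) 0) (bigD1 w)//= big1 ?addr0// => v.
  by rewrite tuple0 (tuple0 w) eqxx.
have pcons n (w : n.-tuple A) :
    p n w = \sum_(w' : n.+1.-tuple A | prefix n (extend w') == w) p n.+1 w'.
  apply/cvg_lim => //; under eq_fun do rewrite (mass_prefix _ w (leqnSn n)).
  by apply: cvg_sumr => w'; exact: pcv.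
have [mu muE] := probability_extension p_ge0 p0 pcons.
have mcv n (w : n.-tuple A) : (fun k => mass (nu k) w) @ F --> mass mu w.
  by rewrite muE.
have lcv n (g : n.-tuple A -> R) :
    (fun k => \sum_w mass (nu k) w * g w) @ F --> \sum_w mass mu w * g w.
  by apply: cvg_sumr => w; apply: cvgM (mcv n w) (cvg_cst _).
exists mu; split.
- apply: shift_invariantP => n w; rewrite law_prefix_shift.
  have c1 : (fun k => law (nu k) (prefix n \o sft) w) @ F -->
      \sum_(w' : n.+1.-tuple A | prefix n (sft (extend w')) == w) mass mu w'.
    under eq_fun do rewrite law_prefix_shift.
    by apply: cvg_sumr => w'; exact: mcv.
  apply/eqP; rewrite -subr_eq0 -normr_le0.
  apply: (@ler_cvg_to _ F _ _ _ _ _ _ (cvg_norm (cvgB c1 (mcv n w))) inv0).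
  apply: nearW => k /=; have [_ h _] := nuP k.
  exact: h _ _ w (@measurable_prefix N n).
- apply: closed_UC => q d d0.
  have : \forall k \near F, forall w : q.-tuple A, `|mass (nu k) w - mass mu w| < d.
    apply: filter_forall => w; have /cvgrPdist_lt/(_ _ d0) := mcv q w.
    by apply: filterS => k; rewrite distrC.
  move=> /filter_ex[k hk]; exists (nu k); split=> //.
  by have [] := nuP k.
- move=> q; apply/ler_addgt0Pr => e e0.
  (* One third each for smoothing the kernel, for replacing phi by its values on words in the bound
     on Z, and for returning from words to the integral of phi. *)
  have e30 : 0 < e / 3 by rewrite divr_gt0.
  have [Q [Q01 Q1 QH]] := smoothed_kernel mu q e30.
  have [r rP] := uniform_oscillation phi_cont e30.
  have ia := integral_approx mu phi_cont rP.
  have L : c <= \sum_w mass mu w * - ln (Q w) +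
      \sum_(w : r.-tuple A) mass mu w * phi (extend w) + e / 3.
    pose K := ln 2 + q%:R * ln (N.+1%:R : R).
    have c2 : (fun k => K * (n_ k)%:R^-1 + (\sum_w mass (nu k) w * - ln (Q w) +
        \sum_(w : r.-tuple A) mass (nu k) w * phi (extend w) + e / 3)) @ F -->
        K * 0 + (\sum_w mass mu w * - ln (Q w) +
      \sum_(w : r.-tuple A) mass mu w * phi (extend w) + e / 3).
      apply: cvgD; first exact: cvgM (cvg_cst _) inv0.
      apply: cvgD (cvg_cst _); apply: cvgD; exact: lcv.
    rewrite mulr0 add0r in c2.
    apply: cvgr_to_ge c2 _.
    have : \forall k \near F, (q <= k)%N by apply: sF; exists q.
    apply: filterS => k qk; have [nk Zk ck] := nP k.
    have [_ _ /(_ q Q r (e / 3))] := nuP k.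
    have qn : (q <= n_ k)%N by rewrite (leq_trans qk)// ltnW.
    move=> /(_ qn Q01 Q1 rP) h; apply: (le_trans ck).
    have nR : 0 < (n_ k)%:R :> R by rewrite ltr0n.
    rewrite -(ler_pM2l nR) mulrA divff ?gt_eqF// mul1r (le_trans h)//.
    by rewrite -/K [leRHS]mulrDr mulrCA divff ?gt_eqF// mulr1.
  move: ia L QH; rewrite ler_norml => /andP[ia1 ia2] L QH; lra.
Unshelve. all: by end_near.
Qed.

End upper_limit.

(** * Entropy of an arbitrary partition *)


Lemma prob_bigsetU_le d (T : measurableType d) (R : realType)
    (mu : probability T R) (I : Type) (r : seq I) (B : I -> set T) :
  (forall i, measurable (B i)) ->
  fine (mu (\big[setU/set0]_(i <- r) B i)) <= \sum_(i <- r) fine (mu (B i)).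
Proof.
move=> mB; elim: r => [|i r IH]; first by rewrite !big_nil measure0.
rewrite !big_cons; apply: le_trans (prob_setU_le mu (mB i) _) _.
  exact: bigsetU_measurable.
by rewrite lerD2l.
Qed.

Section itinerary_entropy.
Context (N : nat) (R : realType) (mu : probability (strings N) R).
Local Notation A := 'I_N.+1.
Local Notation Sig := (strings N).
Local Notation sft := (@string_shift N).
Local Notation H X := (partition_entropy mu X).
Hypothesis mu_inv : shift_invariant mu.

Lemma entropy_shift (I : finType) (X : Sig -> I) k : measurable_label X ->
  H (X \o iter k sft) = H X.
Proof. by move=> mX; rewrite !entropyE law_shift. Qed.

Lemma measurable_itinerary m (xi : Sig -> 'I_m) n :
  measurable_label xi -> measurable_label (itinerary sft xi n).
Proof.
move=> mxi g.
rewrite (_ : _ @^-1` _ =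
  \bigcap_(j in [set: 'I_n]) ((xi \o iter j sft) @^-1` [set g j])).
  apply: fin_bigcap_measurable => // j _.
  exact: measurable_label_shift.
apply/seteqP; split => u /=; first by move=> <- j _ /=; rewrite ffunE.
by move=> h; apply/ffunP => j; rewrite ffunE; exact: h.
Qed.

Lemma itinerary_subadditive l (xi : Sig -> 'I_l) m n : measurable_label xi ->
  H (itinerary sft xi (m + n)) <= H (itinerary sft xi m) + H (itinerary sft xi n).
Proof.
move=> mxi; have mi k := measurable_itinerary (n := k) mxi.
rewrite -(entropy_shift m (mi n)).
have ms := measurable_label_shift m (mi n).
pose f (c : {ffun 'I_m -> 'I_l} * {ffun 'I_n -> 'I_l}) :
  {ffun 'I_(m + n) -> 'I_l} :=
  [ffun j : 'I_(m + n) => match fintype.split j with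
    inl k => c.1 k | inr k => c.2 k end].
rewrite (_ : itinerary sft xi (m + n) =
  f \o pairing (itinerary sft xi m) (itinerary sft xi n \o iter m sft)).
  apply: le_trans (entropy_comp mu f (measurable_label_pair (mi m) ms)) _.
  exact: (entropy_pair_le mu (mi m) ms).
apply/funext => u; apply/ffunP => j; rewrite /f !ffunE.
case: fintype.splitP => k -> /=; rewrite ffunE//.
by rewrite -iterD addnC.
Qed.

Lemma prefix_subadditive m n :
  H (@prefix N (m + n)) <= H (@prefix N m) + H (@prefix N n).
Proof.
have mp k := @measurable_prefix N k.
rewrite -(entropy_shift m (mp n)).
have ms := measurable_label_shift m (mp n).
pose f (c : m.-tuple A * n.-tuple A) := [tuple of c.1 ++ c.2].
rewrite (_ : @prefix N (m + n) = f \o pairing (@prefix N m) (@prefix N n \o iter m sft)).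
  apply: le_trans (entropy_comp mu f (measurable_label_pair (mp m) ms)) _.
  exact: (entropy_pair_le mu (mp m) ms).
apply/funext => u; apply: eq_from_tnth => j; rewrite tnth_mktuple.
case: (fintype.splitP j) => k jk.
  rewrite (_ : j = lshift n k); last exact/val_inj.
  by rewrite tnth_lshift tnth_mktuple.
rewrite (_ : j = rshift m k); last exact/val_inj.
by rewrite tnth_rshift tnth_mktuple iter_shiftE.
Qed.

(* The chain rule adds one coordinate of the [xi]-itinerary at a time; each costs
   at most the conditional entropy of [xi] given the first [q] letters. *)
Lemma itinerary_prefix_le l (xi : Sig -> 'I_l) n q : measurable_label xi ->
  H (itinerary sft xi n) <= H (@prefix N (n + q)) +
    n%:R * (H (pairing xi (@prefix N q)) - H (@prefix N q)).
Proof.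
move=> mxi; have mi k := measurable_itinerary (n := k) mxi.
have mp k := @measurable_prefix N k.
set c := _ - _.
have step M k : (k + q <= M)%N ->
    H (pairing (itinerary sft xi k) (@prefix N M)) <= H (@prefix N M) + k%:R * c.
  elim: k => [_|k IH kM].
    pose f (w : M.-tuple A) := (ffun0 (card_ord 0) : {ffun 'I_0 -> 'I_l}, w).
    rewrite mul0r addr0 (_ : pairing _ _ = f \o @prefix N M).
      exact: (entropy_comp mu f (mp M)).
    apply/funext => u; congr pair; apply/ffunP => -[].
    by [].
  pose Y := pairing (itinerary sft xi k) (@prefix N M).
  have mY : measurable_label Y := measurable_label_pair (mi k) (mp M).
  have kM' : (k + q <= M)%N by apply: leq_trans kM; rewrite leq_add2r.
  have mX := measurable_label_shift k mxi.
  pose g (p : 'I_l * ({ffun 'I_k -> 'I_l} * M.-tuple A)) :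
    {ffun 'I_k.+1 -> 'I_l} * M.-tuple A :=
    ([ffun j : 'I_k.+1 => if unlift ord_max j is Some i then p.2.1 i else p.1],
     p.2.2).
  have -> : pairing (itinerary sft xi k.+1) (@prefix N M) =
      g \o pairing (xi \o iter k sft) Y.
    apply/funext => u; congr pair; apply/ffunP => j; rewrite !ffunE.
    by case: unliftP => [i ->|->]; rewrite ?ffunE//= /bump leqNgt ltn_ord.
  apply: le_trans (entropy_comp mu g (measurable_label_pair mX mY)) _.
  (* Of Y only the q letters from position k on are kept; they lie inside the prefix of length M.
     Together with the new label they form [pairing xi (prefix q)] shifted by k, and invariance
     removes the shift. *)
  pose f (p : {ffun 'I_k -> 'I_l} * M.-tuple A) :=
    prefix q (iter k sft (extend p.2)).
  have fY : f \o Y = @prefix N q \o iter k sft.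
    apply/funext => u; apply: (window_prefix kM').
    by rewrite prefix_extend.
  have := cond_entropy_comp mu f mX mY; rewrite fY.
  rewrite (_ : pairing (xi \o _) (@prefix N q \o _) =
    pairing xi (@prefix N q) \o iter k sft)//.
  rewrite !entropy_shift//; [|exact: mp|exact: (measurable_label_pair mxi (mp q))].
  have -> : H (pairing xi (@prefix N q)) - H (@prefix N q) = c by [].
  rewrite lerBlDl => h; apply: (le_trans h).
  by rewrite -natr1 mulrDl mul1r [leRHS]addrA lerD2r; exact: IH.
apply: le_trans (step (n + q)%N n (leqnn _)).
rewrite (_ : itinerary sft xi n =
  fst \o pairing (itinerary sft xi n) (@prefix N (n + q)))//.
exact: (entropy_comp mu fst (measurable_label_pair (mi n) (mp _))).
Qed.

(** Each atom is approximated by a set of words, and g picks a label whose set contains the word. A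
    wrong guess at u means that the set of the true label misses u or that of a false one contains
    it, so u lies in one of l small symmetric differences. *)
Lemma label_approx l (xi : Sig -> 'I_l) (d : R) : measurable_label xi -> 0 < d ->
  exists q (g : q.-tuple A -> 'I_l), \sum_(c | c.1 != g c.2)
    law mu (pairing xi (@prefix N q)) c < d.
Proof.
move=> mxi d0; pose a0 := xi point.
have l0 : 0 < l%:R :> R by rewrite ltr0n (leq_ltn_trans _ (ltn_ord a0)).
have dl0 : 0 < d / 2 / l%:R by rewrite !divr_gt0.
have /choice[qD qDP] (a : 'I_l) : exists p : {q & set (q.-tuple A)},
    fine (mu (xi @^-1` [set a] `+` prefix (projT1 p) @^-1` projT2 p)) < d / 2 / l%:R.
  have [_ /(_ _ dl0)[q [D h]]] := measurable_approximable mu (mxi a).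
  by exists (existT _ q D).
pose q := \max_(a : 'I_l) projT1 (qD a).
pose inD (a : 'I_l) (w : q.-tuple A) :=
  `[< projT2 (qD a) (prefix (projT1 (qD a)) (extend w)) >].
pose g w := odflt a0 [pick a | inD a w].
exists q, g.
have mp := @measurable_prefix N q.
have mxp := measurable_label_pair mxi mp.
have [mB <-] := law_preimage mu (fun c => c.1 != g c.2) mxp.
pose B a := xi @^-1` [set a] `+` prefix (projT1 (qD a)) @^-1` projT2 (qD a).
have mBa a : measurable (B a).
  by apply: measurable_setY => //; exact: measurable_prefix_set.
have inDE a u : inD a (prefix q u) = `[< projT2 (qD a) (prefix (projT1 (qD a)) u) >].
  congr (`[< projT2 (qD a) _ >]); apply: (@prefix_le _ _ q).
    exact: (leq_bigmax a).
  by rewrite prefix_extend.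
apply: (@le_lt_trans _ _ (fine (mu (\big[setU/set0]_a B a)))).
  apply: prob_le => //; first exact: bigsetU_measurable.
  move=> u /=; rewrite unfold_in /= => ne; rewrite -bigcup_seq.
  have [iD|niD] := boolP (inD (xi u) (prefix q u)); last first.
    exists (xi u); rewrite /= ?mem_index_enum// /B setY_def /=; left; split=> //.
    by move: niD; rewrite inDE => /asboolPn.
  move: ne; rewrite /g; case: pickP => [b /= iDb xb|/(_ (xi u))]; last by rewrite iD.
  exists b; rewrite /= ?mem_index_enum// /B setY_def /=; right; split.
    by move: iDb; rewrite inDE => /asboolP.
  by apply/eqP.
apply: le_lt_trans (prob_bigsetU_le mu _ mBa) _.
apply: (@le_lt_trans _ _ (\sum_(a : 'I_l) d / 2 / l%:R)).
  by apply: ler_sum => a _; exact/ltW/qDP.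
rewrite sumr_const card_ord -[_ *+ l]mulr_natr divfK ?gt_eqF//.
by rewrite ltr_pdivrMr// ltr_pMr// ltr1n.
Qed.

(** The trial kernel gives weight x to the guess [g w] and y to every other label. A right guess
    costs - ln x = e / 2; a wrong one costs - ln y, a constant fixed before g is chosen, so the
    error probability can be made small against it. *)
Lemma cond_entropy_small l (xi : Sig -> 'I_l) (e : R) : measurable_label xi ->
  0 < e -> exists q, H (pairing xi (@prefix N q)) - H (@prefix N q) <= e.
Proof.
move=> mxi e0; pose a0 := xi point.
have l0 : 0 < l%:R :> R by rewrite ltr0n (leq_ltn_trans _ (ltn_ord a0)).
have l1 : 1 <= l%:R :> R by rewrite ler1n -(ltr0n R).
have e20 : 0 < e / 2 by rewrite divr_gt0.
pose x := expR (- (e / 2)); have x0 : 0 < x by exact: expR_gt0.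
have x1 : x < 1 by rewrite expR_lt1 oppr_lt0.
pose y := (1 - x) / l%:R; have y0 : 0 < y by rewrite divr_gt0// subr_gt0.
have y1 : y < 1 by rewrite ltr_pdivrMr// mul1r; lra.
have Ly : 0 < - ln y by rewrite oppr_gt0 ln_lt0// y0.
have [q [g gP]] := label_approx mxi (divr_gt0 e20 Ly).
have mp := @measurable_prefix N q.
have mxp := measurable_label_pair mxi mp.
exists q; pose Q a w := if a == g w then x else y.
have Q0 a w : 0 < Q a w by rewrite /Q; case: eqP.
have Q1 w : \sum_a Q a w <= 1.
  rewrite (bigD1 (g w))//= {1}/Q eqxx.
  rewrite (eq_bigr (fun=> y)) => [|a /negPf an]; last by rewrite /Q an.
  apply: (@le_trans _ _ (x + \sum_(a : 'I_l) y)).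
    rewrite lerD2l [leRHS](bigD1 (g w))//= lerDr; exact: ltW.
  rewrite sumr_const card_ord -[y *+ _]mulr_natr divfK ?gt_eqF//.
  by rewrite addrC subrK.
apply: le_trans (cond_entropy_le mxi mp (fun a w => ltW (Q0 a w)) Q1
  (fun a w _ => Q0 a w)) _.
rewrite -sumrN (bigID (fun c => c.1 == g c.2))/= [leRHS]splitr; apply: lerD.
  apply: (@le_trans _ _ (\sum_(c | c.1 == g c.2)
      law mu (pairing xi (@prefix N q)) c * (e / 2))).
    apply: ler_sum => c cg; rewrite /Q cg -mulrN expRK opprK.
    exact: lexx.
  rewrite -mulr_suml ler_piMl ?(ltW e20)//.
  rewrite -(law_sum mu mxp) [leRHS](bigID (fun c => c.1 == g c.2))/= lerDl.
  by apply: sumr_ge0 => c _; exact: law_ge0.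
rewrite (eq_bigr (fun c => law mu (pairing xi (@prefix N q)) c * - ln y)).
  by rewrite -mulr_suml -ler_pdivlMr// ltW.
by move=> c /negPf cg; rewrite /Q cg mulrN.
Qed.

(** Half of the Kolmogorov-Sinai theorem for the generating partition by letters. The q extra
    letters cost H_q / n, which vanishes, the conditional entropy costs at most e, and by Fekete's
    lemma the limit of H_n / n is below every H_m / m. *)
Lemma entropy_wrt_le l (xi : Sig -> 'I_l) m : measurable_label xi -> (0 < m)%N ->
  entropy_wrt sft mu xi <= m%:R^-1 * H (@prefix N m).
Proof.
move=> mxi m0; apply/ler_addgt0Pr => e e0.
have [q cq] := cond_entropy_small mxi e0.
set c := _ - _ in cq.
have ip n : H (itinerary sft xi n) <= H (@prefix N (n + q)) + n%:R * c.
  exact: itinerary_prefix_le.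
clearbody c; have mi n := measurable_itinerary (n := n) mxi.
have [cvi _] := fekete (fun n => entropy_ge0 mu (mi n))
  (fun m n => itinerary_subadditive m n mxi).
have [cvp limp] := fekete (fun n => entropy_ge0 mu (@measurable_prefix N n))
  prefix_subadditive.
apply: (@le_trans _ _ (limn (fun n => n%:R^-1 * H (@prefix N n)) + 0 + c)); last first.
  by rewrite addr0; apply: lerD => //; exact: limp.
have h0 : (fun n => n%:R^-1 * H (@prefix N q)) @ \oo --> (0 : R).
  rewrite -[X in _ --> X](mul0r (H (@prefix N q))).
  apply: cvgM (cvg_cst _).
  apply/(@gtr0_cvgV0 R nat \oo _ (fun n => n%:R)); last exact: cvgr_idn.
  by exists 1%N => // n /=; rewrite ltr0n.
apply: (@ler_cvg_to _ \oo _ _ (fun n => n%:R^-1 * H (itinerary sft xi n))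
  (fun n => n%:R^-1 * H (@prefix N n) + n%:R^-1 * H (@prefix N q) + c)).
- exact: cvi.
- by apply: cvgD (cvg_cst _); apply: cvgD.
near=> n.
have n0 : 0 < n%:R :> R by rewrite ltr0n; near: n; exists 1%N.
rewrite -(ler_pM2l n0) !mulrDr !mulrA divff ?gt_eqF// !mul1r.
apply: (le_trans (ip n)).
by rewrite lerD2r; exact: prefix_subadditive.
Unshelve. all: by end_near.
Qed.

Lemma entropy_wrt_first_letter : entropy_wrt sft mu (fun u : Sig => u 0%N : A) =
  limn (fun n => n%:R^-1 * H (@prefix N n)).
Proof.
rewrite /entropy_wrt; congr (limn _); apply/funext => n; congr (_ * _).
have mp := @measurable_prefix N n.
pose f (w : n.-tuple A) : {ffun 'I_n -> A} := [ffun i => tnth w i].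
have fE : itinerary sft (fun u : Sig => u 0%N : A) n = f \o @prefix N n.
  apply/funext => u; apply/ffunP => i.
  by rewrite !ffunE tnth_mktuple iter_shiftE addn0.
apply/le_anti; rewrite fE (entropy_comp mu f mp)/=.
pose g (h : {ffun 'I_n -> A}) : n.-tuple A := [tuple h i | i < n].
have gfE : @prefix N n = g \o (f \o @prefix N n).
  by apply/funext => u; apply: eq_from_tnth => i; rewrite !tnth_mktuple ffunE tnth_mktuple.
have := entropy_comp mu g (measurable_label_comp mu f mp).
by rewrite -gfE.
Qed.

End itinerary_entropy.

(** * The lower bound *)


Section independent_blocks.
Context (R : realType) (B : finType) (p : B -> R).
Hypothesis p_ge0 : forall a, 0 <= p a.
Hypothesis p_sum1 : \sum_a p a = 1.

Definition iid K (w : {ffun 'I_K -> B}) : R := \prod_(l < K) p (w l).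

Lemma iid_ge0 K (w : {ffun 'I_K -> B}) : 0 <= iid w.
Proof. exact: prodr_ge0. Qed.

Lemma iid_sum1 K : \sum_(w : {ffun 'I_K -> B}) iid w = 1.
Proof. by rewrite /iid -(bigA_distr_bigA (fun=> p)) big1. Qed.

(** Written as a product over all coordinates, the summand lets the sum factor; for distinct l and
    l' one factor is the mean of h, which is 0. *)
Lemma iid_covariance K (h : B -> R) (l l' : 'I_K) : \sum_a p a * h a = 0 ->
  \sum_(w : {ffun 'I_K -> B}) iid w * (h (w l) * h (w l')) =
  if l == l' then \sum_a p a * h a ^+ 2 else 0.
Proof.
move=> h0; pose F j a := p a * (if j == l then h a else 1) *
  (if j == l' then h a else 1).
have pick (w : {ffun 'I_K -> B}) k :
    \prod_j (if j == k then h (w j) else 1) = h (w k).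
  by rewrite -big_mkcond big_pred1_eq.
rewrite (eq_bigr (fun w : {ffun 'I_K -> B} => \prod_j F j (w j))) => [|w _].
  2: by rewrite mulrA /iid -(pick w l) -(pick w l') -!big_split.
rewrite -(bigA_distr_bigA F) (bigD1 l)//=; case: ifPn => ll'.
  rewrite [X in _ * X]big1 ?mulr1 => [|j jl].
    by apply: eq_bigr => a _; rewrite /F ll' eqxx -mulrA -expr2.
  rewrite -[RHS]p_sum1; apply: eq_bigr => a _.
  by rewrite /F -(eqP ll') (negPf jl) !mulr1.
rewrite [X in X * _](_ : _ = 0) ?mul0r// -[RHS]h0; apply: eq_bigr => a _.
by rewrite /F eqxx (negPf ll') mulr1.
Qed.

Lemma iid_variance K (h : B -> R) : \sum_a p a * h a = 0 ->
  \sum_(w : {ffun 'I_K -> B}) iid w * (\sum_l h (w l)) ^+ 2 =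
  K%:R * \sum_a p a * h a ^+ 2.
Proof.
move=> h0; under eq_bigr do rewrite expr2 big_distrlr/= mulr_sumr.
rewrite exchange_big/=; under eq_bigr => l _.
  under eq_bigr do rewrite mulr_sumr.
  rewrite exchange_big/=; under eq_bigr do rewrite iid_covariance//.
  rewrite (bigD1 l)//= eqxx [X in _ + X]big1 ?addr0; last first.
    by move=> l'; rewrite eq_sym => /negPf ->.
  over.
by rewrite sumr_const card_ord mulr_natl.
Qed.

Lemma iid_chebyshev K (h : B -> R) eta : (0 < K)%N -> 0 < eta ->
  \sum_a p a * h a = 0 ->
  \sum_(w : {ffun 'I_K -> B} | K%:R * eta < `|\sum_l h (w l)|) iid w <=
  (\sum_a p a * h a ^+ 2) / (K%:R * eta ^+ 2).
Proof.
move=> K0 eta0 h0; have KR : 0 < K%:R :> R by rewrite ltr0n.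
have Ke : 0 < K%:R * eta by rewrite mulr_gt0.
rewrite ler_pdivlMr; last by rewrite mulr_gt0// exprn_gt0.
rewrite -(ler_pM2l KR) -iid_variance//.
rewrite mulrCA mulr_suml big_mkcond/=; apply: ler_sum => w _.
case: ifP => [hw|_]; last by rewrite mulr_ge0 ?iid_ge0// sqr_ge0.
rewrite ler_wpM2l ?iid_ge0// mulrA -expr2 -exprMn -(real_normK (num_real (\sum_l _))).
by rewrite ler_sqr ?nnegrE ?normr_ge0 ?ltW.
Qed.

(** Chebyshev's inequality with a union bound over J. Probability 1/2 suffices, since its logarithm
    is negligible after division by the length. *)
Lemma weak_law (J : finType) (g : J -> B -> R) eta : 0 < eta ->
  exists K0, forall K, (K0 <= K)%N ->
    1 / 2 <= \sum_(w : {ffun 'I_K -> B} | [forall j,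
      `|\sum_l g j (w l) - K%:R * \sum_a p a * g j a| <= K%:R * eta]) iid w.
Proof.
move=> eta0; pose m j := \sum_a p a * g j a.
pose h j a := g j a - m j.
have h0 j : \sum_a p a * h j a = 0.
  under eq_bigr do rewrite mulrBr.
  by rewrite sumrB -mulr_suml p_sum1 mul1r subrr.
pose V := \sum_j \sum_a p a * h j a ^+ 2.
have V0 : 0 <= V.
  by apply: sumr_ge0 => j _; apply: sumr_ge0 => a _; rewrite mulr_ge0// sqr_ge0.
have e2 : 0 < eta ^+ 2 by rewrite exprn_gt0.
have [K0 _ K0P] := nbhs_infty_ger (2 * V / eta ^+ 2).
exists K0.+1 => K K0K; have K_gt0 : (0 < K)%N by exact: leq_ltn_trans K0K.
have KR : 0 < K%:R :> R by rewrite ltr0n.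
have VK : 2 * V <= K%:R * eta ^+ 2.
  by rewrite -ler_pdivrMr//; apply: K0P => /=; exact: ltnW.
pose good (w : {ffun 'I_K -> B}) := [forall j,
  `|\sum_l g j (w l) - K%:R * \sum_a p a * g j a| <= K%:R * eta].
have bad : \sum_(w | ~~ good w) iid w <= 1 / 2.
  apply: (@le_trans _ _ (\sum_j \sum_(w : {ffun 'I_K -> B} |
      K%:R * eta < `|\sum_l h j (w l)|) iid w)).
    under [leRHS]eq_bigr do rewrite big_mkcond/=.
    rewrite exchange_big/= big_mkcond/=; apply: ler_sum => w _.
    have ind0 j : 0 <= (if K%:R * eta < `|\sum_l h j (w l)| then iid w else 0).
      by case: ifP => // _; exact: iid_ge0.
    case: ifPn => [|_]; last exact: sumr_ge0.
    move=> /forallPn[j]; rewrite -ltNge => hj.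
    rewrite (bigD1 j)//= ifT; first by rewrite lerDl; exact: sumr_ge0.
    apply: lt_le_trans hj _; rewrite /h sumrB sumr_const card_ord.
    by rewrite mulr_natl.
  apply: (@le_trans _ _ (\sum_j (\sum_a p a * h j a ^+ 2) / (K%:R * eta ^+ 2))).
    by apply: ler_sum => j _; exact: iid_chebyshev.
  rewrite -mulr_suml -/V ler_pdivrMr; last by rewrite mulr_gt0.
  lra.
have := iid_sum1 K; rewrite (bigID good)/= => tot; lra.
Qed.

End independent_blocks.


(** * Counting windows in concatenated blocks *)

Lemma sum_blocks (V : nmodType) (g : nat -> V) K m :
  \sum_(k < K * m) g k = \sum_(l < K) \sum_(r < m) g (l * m + r)%N.
Proof.
elim: K => [|K IH]; first by rewrite mul0n !big_ord0.
by rewrite mulSnr big_split_ord/= IH big_ord_recr.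
Qed.

(* Windows of length [q] that overhang the end of a block of length [m]. *)
Lemma sum_overhang q m : (\sum_(r < m) (m < r + q) <= minn m q)%N.
Proof.
elim: m => [|m IH]; first by rewrite big_ord0.
rewrite big_ord_recl/= add0n.
rewrite (eq_bigr (fun r : 'I_m => (m < r + q)%N : nat)) => [|r _]; last first.
  by rewrite /= /bump /= add1n addSn ltnS.
move: IH; set s := \sum_(_ < _) _ => IH.
by case: ltnP => mq; lia.
Qed.

Section concatenation.
Context (N : nat) (R : realType) (m : nat).
Local Notation A := 'I_N.+1.
Local Notation Sig := (strings N).
Local Notation sft := (@string_shift N).
Hypothesis m_gt0 : (0 < m)%N.

(** [insub] tests whether the block index is below K; past the last block the string continues with
    [ord0], so words of any length n >= K m can be cut from it. *)
Definition concat K (w : {ffun 'I_K -> m.-tuple A}) : Sig :=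
  fun k => if insub (k %/ m)%N is Some l then nth ord0 (w l) (k %% m) else ord0.

Lemma concatE K (w : {ffun 'I_K -> m.-tuple A}) (l : 'I_K) r : (r < m)%N ->
  concat w (l * m + r)%N = extend (w l) r.
Proof.
move=> rm; rewrite /concat divnMDl// divn_small// addn0 modnMDl modn_small//.
by rewrite valK.
Qed.

Lemma prefix_concat_inj K n : (K * m <= n)%N ->
  injective (fun w : {ffun 'I_K -> m.-tuple A} => prefix n (concat w)).
Proof.
move=> Kn w w' /prefixP e; apply/ffunP => l; apply: eq_from_tnth => r.
rewrite !(tnth_nth ord0) -/(extend (w l) r) -/(extend (w' l) r).
rewrite -!concatE//; apply: e; apply: leq_trans Kn.
by rewrite (leq_trans (n := l.+1 * m))// ?leq_mul2r ?ltn_ord ?orbT// mulSnr ltn_add2l.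
Qed.

Lemma concat_window K (w : {ffun 'I_K -> m.-tuple A}) (l : 'I_K) q r :
  (r + q <= m)%N ->
  prefix q (iter (l * m + r) sft (concat w)) =
  prefix q (iter r sft (extend (w l))).
Proof.
move=> rq; apply/prefixP => k kq; rewrite !iter_shiftE -addnA concatE//.
by apply: leq_trans rq; rewrite ltn_add2l.
Qed.

Variables (q : nat) (f : q.-tuple A -> R).
Hypothesis f01 : forall v, 0 <= f v <= 1.

Let f_dist v v' : `|f v - f v'| <= 1.
Proof.
by have /andP[? ?] := f01 v; have /andP[? ?] := f01 v';
  rewrite ler_norml; apply/andP; split; lra.
Qed.

Definition block_sum (a : m.-tuple A) : R :=
  \sum_(r < m) f (prefix q (iter r sft (extend a))).

Let overhang_le (g g' : nat -> R) :
  (forall r, (r + q <= m)%N -> g r = g' r) ->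
  (forall r, `|g r - g' r| <= 1) ->
  `|\sum_(r < m) g r - \sum_(r < m) g' r| <= q%:R.
Proof.
move=> gg' g1; rewrite -sumrB; apply: le_trans (ler_norm_sum _ _ _) _.
apply: (@le_trans _ _ (\sum_(r < m) (m < r + q)%:R)).
  apply: ler_sum => r _; case: ltnP => [_|rq]; first exact: g1.
  by rewrite gg'// subrr normr0.
rewrite -natr_sum ler_nat; apply: leq_trans (sum_overhang q m) _.
exact: geq_minr.
Qed.

(** Each block loses at most q windows, those overhanging its end; the tail after the K blocks has
    at most m positions. *)
Lemma concat_sum K (w : {ffun 'I_K -> m.-tuple A}) n u :
  (K * m <= n <= K * m + m)%N -> prefix n u = prefix n (concat w) ->
  `|\sum_(k < n) f (prefix q (iter k sft u)) - \sum_(l < K) block_sum (w l)| <=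
  K%:R * q%:R + m%:R.
Proof.
move=> /andP[Kn nK] e; have nE := subnKC Kn.
set g := fun k => f (prefix q (iter k sft u)).
have -> : \sum_(k < n) g k =
    \sum_(k < K * m) g k + \sum_(j < n - K * m) g (K * m + j)%N.
  by rewrite -[in LHS]nE big_split_ord.
rewrite addrAC; apply: le_trans (ler_normD _ _) _; apply: lerD.
  rewrite sum_blocks -sumrB; apply: le_trans (ler_norm_sum _ _ _) _.
  rewrite mulr_natl -[K in leRHS]card_ord -sumr_const; apply: ler_sum => l _.
  apply: (@overhang_le (fun r => g (l * m + r)%N)
    (fun r => f (prefix q (iter r sft (extend (w l)))))) => r; last exact: f_dist.
  move=> rq; congr f; rewrite -(concat_window w l rq).
  apply: (@window_prefix _ _ _ n) => //; apply: leq_trans Kn.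
  rewrite -addnA (leq_trans (n := l.+1 * m))// ?leq_mul2r ?ltn_ord ?orbT//.
  by rewrite mulSnr leq_add2l.
apply: le_trans (ler_norm_sum _ _ _) _.
apply: (@le_trans _ _ (\sum_(j < n - K * m) 1)).
  by apply: ler_sum => j _; have /andP[? ?] := f01 (prefix q (iter (K * m + j) sft u));
    rewrite ger0_norm.
by rewrite sumr_const card_ord ler_nat leq_subLR.
Qed.

(** By invariance a window inside the block has the same law under mu at every position; only the at
    most q overhanging ones, which [extend] pads, can deviate. *)
Lemma block_sum_mean (mu : probability Sig R) : shift_invariant mu ->
  `|\sum_(a : m.-tuple A) mass mu a * block_sum a -
    m%:R * \sum_v mass mu v * f v| <= q%:R.
Proof.
move=> inv; have mm := @measurable_prefix N m.
have mq := @measurable_prefix N q.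
under eq_bigr do rewrite mulr_sumr.
rewrite exchange_big/= mulr_natl -[m in X in _ - X]card_ord -sumr_const.
have f01_mean (I : finType) (X : Sig -> I) (F : I -> R) : measurable_label X ->
    (forall i, 0 <= F i <= 1) -> 0 <= \sum_a law mu X a * F a <= 1.
  move=> mX F01; apply/andP; split.
    by apply: sumr_ge0 => a _; rewrite mulr_ge0 ?law_ge0//; have /andP[] := F01 a.
  rewrite -[leRHS](law_sum mu mX); apply: ler_sum => a _.
  by rewrite ler_piMr ?law_ge0//; have /andP[] := F01 a.
apply: (@overhang_le
  (fun r => \sum_(a : m.-tuple A) mass mu a * f (prefix q (iter r sft (extend a))))
  (fun=> \sum_v mass mu v * f v)).
  move=> r rq; pose t (a : m.-tuple A) := prefix q (iter r sft (extend a)).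
  transitivity (\sum_v law mu (t \o @prefix N m) v * f v).
    exact: (law_expect mu t f mm).
  have -> : t \o @prefix N m = @prefix N q \o iter r sft.
    apply/funext => u; apply: (window_prefix rq).
    by rewrite prefix_extend.
  by rewrite law_shift.
move=> r.
have /andP[? ?] := f01_mean _ _ _ mm (fun a => f01 (prefix q (iter r sft (extend a)))).
have /andP[? ?] := f01_mean _ _ _ mq f01.
by rewrite ler_norml; apply/andP; split; rewrite /mass; lra.
Qed.

End concatenation.

Section lower_bound.
Context (R : realType) (N : nat) (X : normedModType R).
Local Notation A := 'I_N.+1.
Local Notation Sig := (strings N).
Local Notation sft := (@string_shift N).
Variables (U : probability Sig R -> X) (C : set X) (phi : Sig -> R).
Hypothesis phi_cont : continuous phi.
Local Notation Z := (partition_function U C phi).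
Local Notation H mu n := (partition_entropy mu (@prefix N n)).

Lemma sum_injective_le (I J : finType) (h : I -> J) (P : pred I) (F : J -> R) :
  injective h -> (forall j, 0 <= F j) -> \sum_(i | P i) F (h i) <= \sum_j F j.
Proof.
move=> ih F0; rewrite (eq_bigl (fun i => i \in [set i | P i]%SET)) => [|i].
  2: by rewrite inE.
rewrite -(big_imset F)/=; last by move=> x y _ _ /ih.
rewrite [leRHS](bigID (fun j => j \in [set h x | x in [set i | P i]%SET]%SET))/=.
by rewrite lerDl sumr_ge0.
Qed.

(** Error budget: K q for windows across block ends, K q for the means of the block sums, K for the
    deviation in the law of large numbers, and m twice, for the tail and for replacing K m by n. *)
Lemma empirical_concat_close (mu : probability Sig R) q d m K
    (w : {ffun 'I_K -> m.-tuple A}) n u :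
  shift_invariant mu -> (0 < m)%N -> (0 < n)%N -> (K * m <= n <= K * m + m)%N ->
  prefix n u = prefix n (concat w) ->
  K%:R * (2 * q%:R + 1) + 2 * m%:R < K%:R * m%:R * d ->
  0 < d ->
  (forall v : q.-tuple A, `|\sum_l block_sum (fun v' => (v' == v)%:R) (w l) -
      K%:R * \sum_(a : m.-tuple A) mass mu a * block_sum (fun v' => (v' == v)%:R) a|
    <= K%:R) ->
  close_prefix mu q d (empirical R n u).
Proof.
move=> inv m0 n0 Kn e bnd d0 good v.
pose f (v' : q.-tuple A) : R := (v' == v)%:R.
have f01 v' : 0 <= f v' <= 1 by rewrite /f; case: eqP => _; rewrite ?lexx ler01.
have nR : 0 < n%:R :> R by rewrite ltr0n.
have mv : \sum_v' mass mu v' * f v' = mass mu v.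
  rewrite (bigD1 v)//= /f eqxx mulr1 big1 ?addr0// => v' /negPf ->.
  by rewrite mulr0.
have h1 := concat_sum m0 f01 Kn e.
have h2 := good v.
have := block_sum_mean m f01 inv; rewrite mv.
move=> /(ler_wpM2l (ler0n R K)); rewrite -[X in X * _](ger0_norm (ler0n R K)).
rewrite -normrM mulrBr mulrA => h3.
have emE : n%:R * mass (empirical R n u) v = \sum_(k < n) f (prefix q (iter k sft u)).
  by rewrite /mass empirical_law// mulrA divff ?gt_eqF// mul1r.
have /andP[p0 p1] : 0 <= mass mu v <= 1.
  by rewrite mass_ge0/=; apply: law_le1; exact: measurable_prefix.
have /andP[n1 n2] := Kn.
have n1R : K%:R * m%:R <= n%:R :> R by rewrite -natrM ler_nat.
have n2R : n%:R <= K%:R * m%:R + m%:R :> R by rewrite -natrM -natrD ler_nat.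
have h4 : `|K%:R * m%:R * mass mu v - n%:R * mass mu v| <= m%:R.
  rewrite -mulrBl normrM (ger0_norm p0) -[leRHS]mulr1 ler_pM//.
  by rewrite distrC ger0_norm ?subr_ge0// lerBlDl.
have h5 : K%:R * m%:R * d <= n%:R * d by rewrite ler_wpM2r// ltW.
rewrite -(ltr_pM2l nR) -[X in X * `|_|](gtr0_norm nR) -normrM mulrBr emE.
move: h1 h2 h3 h4; rewrite !ler_norml => /andP[a1 a2] /andP[b1 b2] /andP[c1 c2] /andP[e1 e2].
rewrite ltr_norml; apply/andP; split; lra.
Qed.

(* Chebyshev is applied with tolerance 1 both to the block counts and to the
   information of the blocks: after division by [m] the error is small. *)
Lemma lower_pressure_bound (mu : probability Sig R) (h : R) :
  shift_invariant mu ->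
  (exists q d, 0 < d /\ forall nu, close_prefix mu q d nu -> C (U nu)) ->
  (forall m, (0 < m)%N -> h <= m%:R^-1 * H mu m) ->
  forall e, 0 < e -> exists n0, forall n, (n0 <= n)%N ->
    0 < Z n /\ h + \int[mu]_x phi x - e <= n%:R^-1 * ln (Z n).
Proof.
move=> inv [q0 [d0 [d0_gt0 CU]]] hH e e0.
(* Three fifths are for phi, one for the unit tolerance on the information of K blocks, and one for
   [ln 2] and the incomplete last block. *)
pose e' := e / 5; have e'0 : 0 < e' by rewrite divr_gt0.
have [r0 r0P] := uniform_oscillation phi_cont e'0.
pose q := maxn q0 r0.
have osc u v : prefix q u = prefix q v -> `|phi u - phi v| <= e'.
  by move=> uv; apply: r0P; apply: prefix_le uv; exact: leq_maxr.
pose S := 1 + \sum_(v : q.-tuple A) `|phi (extend v)|.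
have S0 : 0 < S by rewrite ltr_pwDl// sumr_ge0.
pose d := Num.min (d0 / (#|{: q.-tuple A}|.+1)%:R) (e' / S).
have d_gt0 : 0 < d by rewrite lt_min !divr_gt0.
have closeC nu : close_prefix mu q d nu -> C (U nu).
  move=> cl; apply: CU; apply: (close_prefix_le (leq_maxl q0 r0)) => // v.
  by apply: lt_le_trans (cl v) _; rewrite ge_min lexx.
have closeI nu : close_prefix mu q d nu ->
    \int[mu]_x phi x - 2 * e' <= \sum_(v : q.-tuple A) mass nu v * phi (extend v).
  move=> cl; have := integral_approx mu phi_cont osc.
  have : `|\sum_(v : q.-tuple A) mass nu v * phi (extend v) -
      \sum_(v : q.-tuple A) mass mu v * phi (extend v)| <= e'.
    rewrite -sumrB; apply: le_trans (ler_norm_sum _ _ _) _.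
    apply: (@le_trans _ _ (e' / S * (S - 1))).
      rewrite {2}/S addrAC subrr add0r mulr_sumr; apply: ler_sum => v _.
      rewrite -mulrBl normrM ler_wpM2r//; apply: le_trans (ltW (cl v)) _.
      by rewrite ge_min lexx orbT.
    by rewrite mulrBr mulr1 divfK ?gt_eqF// lerBlDr lerDl divr_ge0// ltW.
  by rewrite !ler_norml => /andP[? ?] /andP[? ?]; lra.
(* m is so large that the errors K (2 q + 1) take at most a quarter of K m d; [K1] below makes the
   tail 2 m at most another quarter. [m1] gives K <= n e'. *)
have [m0 _ m0P] := nbhs_infty_ger (4 * (2 * q%:R + 1) / d).
have [m1 _ m1P] := nbhs_infty_ger e'^-1.
pose m := (maxn m0 m1).+1.
have m_gt0 : (0 < m)%N by [].
have mR : 0 < m%:R :> R by rewrite ltr0n.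
have md : 4 * (2 * q%:R + 1) <= m%:R * d.
  by rewrite -ler_pdivrMr//; apply: m0P; rewrite /= ltnW// ltnS leq_maxl.
have me : 1 <= m%:R * e'.
  by rewrite -ler_pdivrMr// mul1r; apply: m1P; rewrite /= ltnW// ltnS leq_maxr.
have mm := @measurable_prefix N m.
(* [Some v] indexes the count of v and [None] the information of a block, so one event ensures both
   admissibility and the entropy estimate. *)
pose g (j : option (q.-tuple A)) (a : m.-tuple A) : R :=
  if j is Some v then block_sum (fun v' => (v' == v)%:R) a else - ln (mass mu a).
have [K0 K0P] := weak_law (fun a => mass_ge0 mu a) (mass_sum1 mu m) g (@ltr01 R).
have [K1 _ K1P] := nbhs_infty_ger (8 / d).
have [n1 _ n1P] := nbhs_infty_ger ((ln 2 + H mu m) / e').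
pose n0 := maxn ((maxn K0 K1).+1 * m)%N n1.+1.
exists n0 => n n0n; pose K := (n %/ m)%N.
have n_gt0 : (0 < n)%N by apply: leq_trans n0n; rewrite leq_max orbT.
have nR : 0 < n%:R :> R by rewrite ltr0n.
have KK : (maxn K0 K1 < K)%N.
  by rewrite /K leq_divRL// (leq_trans _ n0n)// leq_maxl.
have Kn : (K * m <= n <= K * m + m)%N.
  rewrite leq_trunc_div/= {1}(divn_eq n m) leq_add2l; exact/ltnW/ltn_pmod.
have K0K : (K0 <= K)%N by rewrite (leq_trans (leq_maxl _ _) (ltnW KK)).
have K1K : (K1 <= K)%N by rewrite (leq_trans (leq_maxr _ _) (ltnW KK)).
have KR : 0 < K%:R :> R by rewrite ltr0n (leq_ltn_trans _ KK).
have Kd : 8 <= K%:R * d by rewrite -ler_pdivrMr//; exact: K1P.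
have bnd : K%:R * (2 * q%:R + 1) + 2 * m%:R < K%:R * m%:R * d.
  have x1 : K%:R * (4 * (2 * q%:R + 1)) <= K%:R * (m%:R * d) by rewrite ler_pM2l.
  have x2 : m%:R * 8 <= m%:R * (K%:R * d) by rewrite ler_pM2l.
  have x3 : 0 < K%:R * m%:R * d by rewrite !mulr_gt0.
  have -> : K%:R * m%:R * d = K%:R * (m%:R * d) by rewrite mulrA.
  have x4 : m%:R * (K%:R * d) = K%:R * (m%:R * d) by rewrite mulrCA.
  rewrite x4 in x2; rewrite -mulrA in x3; lra.
pose P (w : {ffun 'I_K -> m.-tuple A}) := iid (fun a => mass mu a) w.
pose good (w : {ffun 'I_K -> m.-tuple A}) := [forall j,
  `|\sum_l g j (w l) - K%:R * \sum_a mass mu a * g j a| <= K%:R * 1].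
have goodP : 1 / 2 <= \sum_(w | good w) P w by exact: K0P.
pose E := n%:R * (\int[mu]_x phi x - 3 * e') + K%:R * (H mu m - 1).
have cl w u : good w -> prefix n u = prefix n (concat w) ->
    close_prefix mu q d (empirical R n u).
  move=> /forallP gw eu; apply: (empirical_concat_close inv m_gt0 n_gt0 Kn eu bnd) => //.
  by move=> v; have := gw (Some v); rewrite mulr1.
(* Equipartition: a good concatenation has probability at most exp (- K (H_m - 1)), so its term in Z
   is at least exp E times its probability. Summing uses only that the good ones have total
   probability at least 1/2. *)
have wZ w : good w -> expR E * P w <=
    if `[< admissible U C (prefix n (concat w)) >]
    then cylinder_sup phi (prefix n (concat w)) else 0.
  move=> gw; rewrite asboolT; last first.
    move=> _ [u iu <-]; apply: closeC; apply: (cl w) => //.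
    by move: iu; rewrite cylinderE.
  have := iid_ge0 (fun a => mass_ge0 mu a) w; rewrite -/(P w) le_eqVlt.
  move=> /predU1P[<-|Pw]; first by rewrite mulr0 ltW// cylinder_sup_gt0.
  have pl l : 0 < mass mu (w l).
    rewrite lt_neqAle mass_ge0 andbT eq_sym; apply: contraTneq Pw => wl0.
    by rewrite /P /iid (bigD1 l)//= wl0 mul0r ltxx.
  apply: le_trans (cylinder_sup_ge phi_cont (erefl (prefix n (concat w)))).
  rewrite -[P w]lnK ?posrE// -expRD ler_expR /E.
  have lnP : ln (P w) <= - (K%:R * (H mu m - 1)).
    rewrite /P /iid ln_prod//.
    have := forallP gw None; rewrite /= mulr1.
    rewrite [X in _ - K%:R * X](_ : _ = H mu m); last first.
      by rewrite entropyE -sumrN; apply: eq_bigr => a _; rewrite mulrN.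
    rewrite sumrN ler_norml => /andP[? ?]; lra.
  have bk : n%:R * (\int[mu]_x phi x - 3 * e') <= birkhoff phi n (concat w).
    have := birkhoff_approx (concat w) n_gt0 osc.
    have := closeI _ (cl w (concat w) gw erefl).
    move=> /(ler_wpM2l (ler0n R n)) z1; rewrite ler_norml => /andP[z2 z3].
    rewrite /birkhoff; move: z1 z2 z3; rewrite !mulrBr; lra.
  lra.
have Zge : expR E / 2 <= Z n.
  have inj := @prefix_concat_inj N m m_gt0 K n (proj1 (andP Kn)).
  rewrite partition_functionE.
  apply: le_trans (@sum_injective_le _ _ _ good
    (fun i => if `[< admissible U C i >] then cylinder_sup phi i else 0) inj _).
    apply: (@le_trans _ _ (\sum_(w | good w) expR E * P w)).
      by rewrite -mulr_sumr ler_pM2l ?expR_gt0// -[_^-1]mul1r.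
    exact: ler_sum.
  move=> i; case: ifP => // _; exact/ltW/cylinder_sup_gt0.
have Z0 : 0 < Z n by apply: lt_le_trans Zge; rewrite divr_gt0 ?expR_gt0.
split=> //; rewrite -(ler_pM2l nR) [leRHS]mulrA divff ?gt_eqF// mul1r.
have lnZ : E - ln 2 <= ln (Z n).
  rewrite -[E in leLHS]expRK -ln_div ?posrE ?expR_gt0//.
  by rewrite ler_ln ?posrE ?divr_gt0 ?expR_gt0.
apply: le_trans lnZ.
have H0 : 0 <= H mu m by apply: entropy_ge0.
have /andP[n2 n3] := Kn.
have n2R : K%:R * m%:R <= n%:R :> R by rewrite -natrM ler_nat.
have n3R : n%:R <= K%:R * m%:R + m%:R :> R by rewrite -natrM -natrD ler_nat.
have hm : m%:R * h <= H mu m.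
  by rewrite -[leRHS](mulVKf (lt0r_neq0 mR)) ler_pM2l// hH.
have Ke : K%:R <= n%:R * e'.
  apply: (@le_trans _ _ (K%:R * (m%:R * e'))).
    by rewrite ler_peMr// ltW.
  by rewrite mulrA ler_wpM2r// ltW.
have nh : n%:R * h <= K%:R * H mu m + H mu m.
  rewrite -(ler_pM2l mR) mulrCA.
  apply: (@le_trans _ _ (n%:R * H mu m)); first by rewrite ler_pM2l.
  rewrite -[X in _ + X]mul1r -mulrDl mulrA ler_wpM2r//.
  by rewrite mulrDr mulr1 [m%:R * K%:R]mulrC.
have ne : ln 2 + H mu m <= n%:R * e'.
  by rewrite -ler_pdivrMr//; apply: n1P; apply: ltnW; apply: leq_trans n0n; exact: leq_maxr.
have e5 : e = 5 * e' by rewrite /e' mulrC divfK.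
rewrite /E e5; move: nh ne Ke; rewrite !mulrBr !mulrDr mulr1; lra.
Qed.

End lower_bound.

(** * The two suprema and the radius of convergence *)


Section quotient.
Context (R : realType) (N : nat) (X : normedModType R).
Local Notation Prob := (probability (strings N) R).
Variables (Gamma : Prob -> X) (Delta : Prob -> R).
Hypothesis Gamma_cont : continuous (Gamma : weak_probability N R -> X).
Hypothesis Gamma_affine : affine Gamma.
Hypothesis Delta_cont : continuous (Delta : weak_probability N R -> R).
Hypothesis Delta_affine : affine (Delta : Prob -> R^o).
Hypothesis Delta_neq0 : forall mu, Delta mu != 0.
Variable U : Prob -> X.
Hypothesis U_def : forall mu, U mu = (Delta mu)^-1 *: Gamma mu.

Let DeltaE (t : {i01 R}) mu nu :
  Delta (pconv t mu nu) = t%:num * Delta mu + (1 - t%:num) * Delta nu.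
Proof. exact: Delta_affine. Qed.

(* A sign change would make [Delta] vanish at some convex combination. *)
Lemma Delta_same_sign mu nu : 0 < Delta mu * Delta nu.
Proof.
rewrite lt_neqAle eq_sym mulf_neq0//= leNgt; apply/negP => lt0.
have d0 : Delta nu - Delta mu != 0.
  apply: contraTneq lt0 => /subr0_eq ->.
  by rewrite -leNgt -expr2 sqr_ge0.
have sq0 : 0 < (Delta nu - Delta mu) ^+ 2 by rewrite exprn_even_gt0.
(* The weight at which t Delta mu + (1 - t) Delta nu vanishes. *)
have t0 : 0 <= Delta nu / (Delta nu - Delta mu).
  have -> : Delta nu / (Delta nu - Delta mu) =
      (Delta nu ^+ 2 - Delta mu * Delta nu) / (Delta nu - Delta mu) ^+ 2.
    by field.
  by rewrite divr_ge0 ?(ltW sq0)// subr_ge0 (le_trans (ltW lt0))// sqr_ge0.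
have t1 : Delta nu / (Delta nu - Delta mu) <= 1.
  rewrite -subr_ge0.
  have -> : 1 - Delta nu / (Delta nu - Delta mu) =
      (Delta mu ^+ 2 - Delta mu * Delta nu) / (Delta nu - Delta mu) ^+ 2.
    by field.
  by rewrite divr_ge0 ?(ltW sq0)// subr_ge0 (le_trans (ltW lt0))// sqr_ge0.
have /eqP[] := Delta_neq0 (pconv (Itv01 t0 t1) mu nu).
by rewrite DeltaE/=; field.
Qed.

(** The weights are redistributed in proportion to Delta: s = t Delta mu / Delta ([pconv t mu nu]),
    which lies in the unit interval because Delta has constant sign. The second clause later keeps
    mixtures in the interior of C. *)
Lemma quotient_pconv (t : {i01 R}) mu nu : exists s : {i01 R},
  U (pconv t mu nu) = s%:num *: U mu + (1 - s%:num) *: U nu /\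
  (t%:num < 1 -> s%:num < 1).
Proof.
pose D := Delta (pconv t mu nu).
have D0 : D != 0 by exact: Delta_neq0.
have D2 : 0 < D ^+ 2 by rewrite exprn_even_gt0.
have t0 : 0 <= t%:num by [].
have t1 : 0 <= 1 - t%:num by rewrite subr_ge0.
have mD : 0 < Delta mu * D by exact: Delta_same_sign.
have nD : 0 < Delta nu * D by exact: Delta_same_sign.
pose s := t%:num * Delta mu / D.
have s0 : 0 <= s.
  have -> : s = t%:num * (Delta mu * D) / D ^+ 2 by rewrite /s; field.
  by rewrite divr_ge0 ?(ltW D2)// mulr_ge0// ltW.
have s1E : 1 - s = (1 - t%:num) * Delta nu / D.
  rewrite -[X in X - _](divff D0) -mulrBl; congr (_ / _).
  by rewrite /D DeltaE; ring.
have s1E' : 1 - s = (1 - t%:num) * (Delta nu * D) / D ^+ 2.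
  by rewrite s1E; field.
have s1 : s <= 1.
  by rewrite -subr_ge0 s1E' divr_ge0 ?(ltW D2)// mulr_ge0// ltW.
exists (Itv01 s0 s1); rewrite /= s1E; split; last first.
  move=> tlt; rewrite -subr_gt0 s1E' divr_gt0// mulr_gt0//.
  by rewrite subr_gt0.
rewrite !U_def Gamma_affine -/D scalerDr !scalerA.
congr (_ *: _ + _ *: _); rewrite ?/s; field; rewrite ?D0 ?Delta_neq0//.
Qed.

Lemma quotient_continuous : continuous (U : weak_probability N R -> X).
Proof.
move=> mu; rewrite /continuous_at.
rewrite (_ : U = (fun nu => (Delta nu)^-1 *: Gamma nu)); last exact/funext.
have Dc := @Delta_cont mu; have Gc := @Gamma_cont mu.
exact: (cvgZ (cvgV (Delta_neq0 mu) Dc) Gc).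
Qed.

Variable C : set X.
Hypothesis C_closed : closed C.
Hypothesis C_convex : convex_set C.

Lemma convex_setP x y (s : {i01 R}) : C x -> C y ->
  C (s%:num *: x + (1 - s%:num) *: y).
Proof.
move=> Cx Cy; have := C_convex s (mem_set Cx) (mem_set Cy).
by rewrite inE.
Qed.

(** A point w near the combination is the same combination of x with a point y' near y: the ball
    around y is shrunk by the factor 1 - s towards x. *)
Lemma convex_interior x y (s : {i01 R}) : C x -> C° y -> s%:num < 1 ->
  C° (s%:num *: x + (1 - s%:num) *: y).
Proof.
move=> Cx /nbhs_ballP[r /= r0 rC] s1.
have s1' : 0 < 1 - s%:num by rewrite subr_gt0.
apply/nbhs_ballP; exists ((1 - s%:num) * r) => /=; first by rewrite mulr_gt0.
move=> w; rewrite -ball_normE /= => hw.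
pose y' := y - (1 - s%:num)^-1 *: (s%:num *: x + (1 - s%:num) *: y - w).
have Cy' : C y'.
  apply: rC; rewrite -ball_normE /= /y' opprB addrC subrK normrZ.
  by rewrite gtr0_norm ?invr_gt0// ltr_pdivrMl.
have -> : w = s%:num *: x + (1 - s%:num) *: y'.
  by rewrite /y' scalerBr scalerA divff ?gt_eqF// scale1r addrA subKr.
exact: convex_setP.
Qed.

Lemma quotient_convex t mu nu : C (U mu) -> C (U nu) -> C (U (pconv t mu nu)).
Proof.
move=> Cm Cn; have [s [-> _]] := quotient_pconv t mu nu.
exact: convex_setP.
Qed.

Lemma quotient_closed (mu : Prob) :
  (forall q d, 0 < d -> exists nu, close_prefix mu q d nu /\ C (U nu)) -> C (U mu).
Proof.
move=> h; apply: contrapT => nC.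
have : nbhs (U mu) (~` C) by apply: open_nbhs_nbhs; split=> //; exact: closed_openC.
move=> /(weak_continuous_nbhs quotient_continuous)[q [d [d0 dP]]].
by have [nu [/dP]] := h q d d0.
Qed.

Lemma quotient_interior (mu : Prob) : C° (U mu) ->
  exists q d, 0 < d /\ forall nu, close_prefix mu q d nu -> C (U nu).
Proof. exact: weak_continuous_nbhs quotient_continuous. Qed.

End quotient.


(** * Entropy and integrals of mixtures *)

Section mixtures.
Context (R : realType) (N : nat).
Local Notation Sig := (strings N).
Local Notation sft := (@string_shift N).
Implicit Types mu nu : probability Sig R.

Lemma pconv_law t mu nu (I : Type) (X : Sig -> I) a : measurable_label X ->
  law (pconv t mu nu) X a = t%:num * law mu X a + (1 - t%:num) * law nu X a.
Proof. by move=> mX; apply: pconvE; exact: mX. Qed.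

Lemma pconv_invariant t mu nu : shift_invariant mu -> shift_invariant nu ->
  shift_invariant (pconv t mu nu).
Proof.
move=> imu inu B mB.
have mS : measurable (sft @^-1` B).
  by rewrite -[X in measurable X]setTI; exact: measurable_shift.
apply: (@eq_trans _ _ (fine (pconv t mu nu (sft @^-1` B)))%:E).
  by rewrite fineK// prob_fin_num.
rewrite -[RHS]fineK ?prob_fin_num//; congr EFin.
by rewrite !pconvE// imu// inu.
Qed.

Lemma pconv_integral (f : Sig -> R) t mu nu : continuous f ->
  (\int[pconv t mu nu]_x f x = t%:num * \int[mu]_x f x +
    (1 - t%:num) * \int[nu]_x f x)%R.
Proof.
move=> cf; apply/eqP; rewrite -subr_eq0 -normr_le0; apply/ler_addgt0Pr => e e0.
rewrite add0r; have e20 : 0 < e / 2 by rewrite divr_gt0.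
have [q osc] := uniform_oscillation cf e20.
have t0 : 0 <= t%:num by [].
have t1 : 0 <= 1 - t%:num by rewrite subr_ge0.
have := integral_approx (pconv t mu nu) cf osc.
have := integral_approx mu cf osc; have := integral_approx nu cf osc.
have -> : \sum_(w : q.-tuple 'I_N.+1) mass (pconv t mu nu) w * f (extend w) =
    t%:num * \sum_(w : q.-tuple 'I_N.+1) mass mu w * f (extend w) +
    (1 - t%:num) * \sum_(w : q.-tuple 'I_N.+1) mass nu w * f (extend w).
  rewrite !mulr_sumr -big_split/=; apply: eq_bigr => w _.
  rewrite /mass pconv_law; last exact: measurable_prefix.
  by rewrite mulrDl !mulrA.
set a := \int[mu]_x f x; set b := \int[nu]_x f x.
set a' := \sum_w mass mu w * _; set b' := \sum_w mass nu w * _.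
move=> hb ha hc.
have ha' : `|t%:num * a - t%:num * a'| <= t%:num * (e / 2).
  by rewrite -mulrBr normrM (ger0_norm t0) ler_wpM2l.
have hb' : `|(1 - t%:num) * b - (1 - t%:num) * b'| <= (1 - t%:num) * (e / 2).
  by rewrite -mulrBr normrM (ger0_norm t1) ler_wpM2l.
move: hc ha' hb'; rewrite !ler_norml => /andP[? ?] /andP[? ?] /andP[? ?].
apply/andP; split; lra.
Qed.

(** Concavity from Gibbs' inequality, applied to mu and to nu against the law of the mixture; as t
    is strictly between 0 and 1, the mixture charges whatever either measure charges. *)
Lemma pconv_entropy t mu nu (I : finType) (X : Sig -> I) : measurable_label X ->
  0 < t%:num < 1 ->
  t%:num * partition_entropy mu X + (1 - t%:num) * partition_entropy nu X <=
  partition_entropy (pconv t mu nu) X.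
Proof.
move=> mX /andP[t0 t1]; have t1' : 0 < 1 - t%:num by rewrite subr_gt0.
set m := pconv t mu nu.
have mE a : law m X a = t%:num * law mu X a + (1 - t%:num) * law nu X a.
  exact: pconv_law.
have g1 : partition_entropy mu X <= - \sum_a law mu X a * ln (law m X a).
  apply: gibbs => [a|a|a a0|]; [exact: law_ge0|exact: law_ge0| |].
    by rewrite mE ltr_pwDl ?mulr_gt0// mulr_ge0 ?law_ge0// ltW.
  by rewrite !law_sum.
have g2 : partition_entropy nu X <= - \sum_a law nu X a * ln (law m X a).
  apply: gibbs => [a|a|a a0|]; [exact: law_ge0|exact: law_ge0| |].
    by rewrite mE ltr_wpDl ?mulr_gt0// mulr_ge0 ?law_ge0// ltW.
  by rewrite !law_sum.
apply: le_trans (lerD (ler_wpM2l (ltW t0) g1) (ler_wpM2l (ltW t1') g2)) _.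
rewrite entropyE !mulrN -opprD lerN2 !mulr_sumr -big_split/= le_eqVlt.
apply/orP; left; apply/eqP; apply: eq_bigr => a _.
by rewrite mulrA [in RHS]mulrA -mulrDl -mE.
Qed.

Lemma entropy_wrt_cvg mu l (xi : Sig -> 'I_l) : shift_invariant mu ->
  measurable_label xi ->
  (fun n => n%:R^-1 * partition_entropy mu (itinerary sft xi n)) @ \oo -->
  entropy_wrt sft mu xi.
Proof.
move=> inv mxi; have mi n := measurable_itinerary (n := n) mxi.
have [cv _] := fekete (fun n => entropy_ge0 mu (mi n))
  (fun m n => itinerary_subadditive inv m n mxi).
exact: cv.
Qed.

Lemma pconv_entropy_wrt t mu nu l (xi : Sig -> 'I_l) :
  shift_invariant mu -> shift_invariant nu -> measurable_label xi ->
  0 < t%:num < 1 ->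
  t%:num * entropy_wrt sft mu xi <= entropy_wrt sft (pconv t mu nu) xi.
Proof.
move=> imu inu mxi t01; have mi n := measurable_itinerary (n := n) mxi.
have c1 := entropy_wrt_cvg imu mxi.
have c2 := entropy_wrt_cvg (pconv_invariant t imu inu) mxi.
apply: (@ler_cvg_to _ \oo _ _ _ _ _ _ (cvgM (cvg_cst t%:num) c1) c2).
apply: nearW => n /=; rewrite mulrCA ler_wpM2l ?invr_ge0//.
apply: le_trans (pconv_entropy mu nu (mi n) t01).
rewrite lerDl mulr_ge0//; last exact: entropy_ge0 (mi n).
Qed.

(** The increments telescope to n c <= H_n, and the partition by the first letter has entropy lim
    H_n / n. *)
Lemma entropy_ge_rate mu (c : R) :
  (forall q, c <= partition_entropy mu (@prefix N q.+1) -
    partition_entropy mu (@prefix N q)) -> shift_invariant mu ->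
  (c%:E <= entropy sft mu)%E.
Proof.
move=> hc inv; apply: (@le_trans _ _ (entropy_wrt sft mu (fun u : Sig => u 0%N))%:E).
  rewrite lee_fin entropy_wrt_first_letter.
  have [cv _] := fekete (fun n => entropy_ge0 mu (@measurable_prefix N n))
    (prefix_subadditive inv).
  apply: limr_ge => //; exists 1%N => // n /= n0.
  have nR : 0 < n%:R :> R by rewrite ltr0n.
  rewrite -(ler_pM2l nR) mulrA divff ?gt_eqF// mul1r.
  elim: n {n0 nR} => [|n IH]; first by rewrite mul0r entropy_ge0//; exact: measurable_prefix.
  by rewrite -natr1 mulrDl mul1r; move: IH (hc n); lra.
apply: ereal_sup_ubound; exists N.+1, (fun u : Sig => u 0%N); split => // a.
rewrite (_ : _ @^-1` _ = prefix 1 @^-1` [set w | tnth w ord0 = a]).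
  exact: measurable_prefix_set.
by apply/seteqP; split => u /=; rewrite tnth_mktuple.
Qed.

Lemma integral_EFin mu (f : Sig -> R) : continuous f ->
  (\int[mu]_x (f x)%:E)%E = (\int[mu]_x f x)%R%:E.
Proof.
move=> cf; rewrite /Rintegral fineK//; apply: integrable_fin_num => //.
exact: continuous_integrable.
Qed.

End mixtures.

Section variational.
Context (R : realType) (N : nat) (X : normedModType R).
Local Notation Sig := (strings N).
Local Notation sft := (@string_shift N).
Variables (U : probability Sig R -> X) (C : set X) (phi : Sig -> R).
Hypothesis phi_cont : continuous phi.
Local Notation V D := (variational_sup U phi D).

(** Both suprema are unfolded, so that later arguments handle one partition and real numbers
    only. *)
Lemma variational_le D (L : \bar R) :
  (forall mu, shift_invariant mu -> D (U mu) ->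
    forall l (xi : Sig -> 'I_l), measurable_label xi ->
    ((entropy_wrt sft mu xi + \int[mu]_x phi x)%R%:E <= L)%E) ->
  (V D <= L)%E.
Proof.
move=> h; apply: ge_ereal_sup => _ [mu [inv Dmu] <-].
rewrite integral_EFin// -leeBrDr//; apply: ge_ereal_sup => _ [l [xi [mxi ->]]].
by rewrite leeBrDr// -EFinD; exact: h.
Qed.

Lemma variational_ge D mu l (xi : Sig -> 'I_l) : shift_invariant mu -> D (U mu) ->
  measurable_label xi ->
  ((entropy_wrt sft mu xi + \int[mu]_x phi x)%R%:E <= V D)%E.
Proof.
move=> inv Dmu mxi; apply: (@le_trans _ _ (entropy sft mu + \int[mu]_x (phi x)%:E)%E).
  rewrite integral_EFin// EFinD leeD2r//.
  by apply: ereal_sup_ubound; exists l, xi.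
by apply: ereal_sup_ubound; exists mu.
Qed.

Lemma variational_interior nu : shift_invariant nu -> C° (U nu) ->
  (forall (t : {i01 R}) mu, C (U mu) -> t%:num < 1 -> C° (U (pconv t mu nu))) ->
  (V C <= V C°)%E.
Proof.
move=> inu Cnu Ct; apply: variational_le => mu imu Cmu l xi mxi.
have := variational_ge (D := C°) inu Cnu mxi.
case E : (V C°) => [v| |] // _; last by rewrite leey.
rewrite lee_fin; apply/ler_addgt0Pr => e e0.
set a := _ + _; pose b := \int[nu]_x phi x.
have ab0 : 0 <= `|a - b| by [].
(* r is the weight of nu in the mixture, small enough that trading a for b with weight r costs at
   most e. The entropy of nu is nonnegative and is dropped, hence b is only an integral. *)
pose r := e / (e + `|a - b| + 1).
have s0 : 0 < e + `|a - b| + 1 by lra.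
have r0 : 0 < r by rewrite divr_gt0.
have r1 : r < 1 by rewrite ltr_pdivrMr// mul1r; lra.
have re : r * `|a - b| <= e.
  by rewrite /r mulrAC ler_pdivrMr// ler_pM2l//; lra.
have t0 : 0 <= 1 - r by lra.
have t1 : 1 - r <= 1 by lra.
pose t : {i01 R} := Itv01 t0 t1.
have t01 : 0 < t%:num < 1 by rewrite /=; apply/andP; split; lra.
have Cm : C° (U (pconv t mu nu)) by apply: Ct => //; have /andP[] := t01.
have := variational_ge (D := C°) (pconv_invariant t imu inu) Cm mxi.
rewrite E lee_fin pconv_integral//.
have := pconv_entropy_wrt imu inu mxi t01.
have : r * (a - b) <= e.
  apply: le_trans re; rewrite ler_pM2l//; exact: ler_norm.
by rewrite /a -/b /=; lra.
Qed.

End variational.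


(** * Exponential growth and the root test *)

Section exponential_rate.
Context (R : realType) (Z : nat -> R) (L : R).
Hypothesis Z_ge0 : forall n, 0 <= Z n.
Hypothesis rate : forall e, 0 < e -> exists n0, forall n, (n0 <= n)%N ->
  0 < Z n /\ L - e <= n%:R^-1 * ln (Z n) <= L + e.

Lemma rate_cvg :
  (fun n => n%:R^-1%:E * lne (Z n)%:E)%E @ \oo --> L%:E.
Proof.
have lnE n : 0 < Z n -> (n%:R^-1%:E * lne (Z n)%:E)%E = (n%:R^-1 * ln (Z n))%:E.
  by move=> Zn; rewrite lne_EFin// EFinM.
apply/fine_cvgP; split.
  have [n0 h] := rate (@ltr01 R); exists n0 => // n /= /h[Zn _].
  by rewrite lnE.
apply/cvgrPdist_le => e e0; have [n0 h] := rate e0.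
exists n0 => // n /= /h[Zn /andP[? ?]]; rewrite lnE//= distrC ler_norml.
by apply/andP; split; lra.
Qed.

Let rate_exp e : 0 < e -> exists n0, forall n, (n0 <= n)%N ->
  expR (n%:R * (L - e)) <= Z n <= expR (n%:R * (L + e)).
Proof.
move=> e0; have [n0 h] := rate e0; exists n0.+1 => n n0n.
have nR : 0 < n%:R :> R by rewrite ltr0n (leq_ltn_trans _ n0n).
have [Zn /andP[h1 h2]] := h n (ltnW n0n).
have lnE : ln (Z n) = n%:R * (n%:R^-1 * ln (Z n)) by rewrite mulVKf ?gt_eqF.
by rewrite -[Z n]lnK ?posrE// !ler_expR lnE !ler_pM2l// h1.
Qed.

(** Absorbs the factor 1/n of the zeta coefficients: exp x >= x at x = n e / 2, squared, is at least
    n once n e^2 >= 4. *)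
Let linear_le_exp (e : R) : 0 < e -> exists n0, forall n, (n0 <= n)%N ->
  n%:R <= expR (n%:R * e).
Proof.
move=> e0; have [n0 _ h] := nbhs_infty_ger (4 / e ^+ 2); exists n0 => n n0n.
have n4 : 4 <= n%:R * e ^+ 2 by rewrite -ler_pdivrMr ?exprn_gt0//; exact: h.
have -> : n%:R * e = n%:R * e / 2 + n%:R * e / 2 by rewrite -splitr.
rewrite expRD -expr2.
have x0 : 0 <= n%:R * e / 2 by rewrite divr_ge0// mulr_ge0// ltW.
have x1 : n%:R * e / 2 <= expR (n%:R * e / 2).
  by apply: le_trans (expR_ge1Dx _); rewrite lerDr.
apply: (@le_trans _ _ ((n%:R * e / 2) ^+ 2)); last by rewrite ler_sqr ?nnegrE ?expR_ge0.
have -> : (n%:R * e / 2) ^+ 2 = n%:R * (n%:R * e ^+ 2) / 4 by field.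
by rewrite ler_pdivlMr// ler_wpM2l.
Qed.

Lemma radius_rate :
  radius_of_convergence (fun n => n%:R^-1 * Z n) = (expR (- L))%:E.
Proof.
apply/le_anti/andP; split.
  apply: ge_ereal_sup => _ [z /= cz <-]; rewrite lee_fin leNgt; apply/negP => zL.
  have z0 : 0 < `|z| by apply: lt_trans zL; exact: expR_gt0.
  have e0 : 0 < (ln `|z| + L) / 3.
    by rewrite divr_gt0// -ltrBlDr sub0r -ltr_expR lnK ?posrE.
  (* With this e, eventually Z_n |z|^n >= exp (2 n e) >= n, so the terms of the series do not tend
     to 0. *)
  set e := _ / 3 in e0.
  have ez : ln `|z| = 3 * e - L by rewrite /e mulrC divfK// addrK.
  have [n1 h1] := rate_exp e0; have [n2 h2] := linear_le_exp e0.
  have /cvgrPdist_lt/(_ _ (@ltr01 R))[n3 _ h3] := cvg_series_cvg_0 cz.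
  pose n := (n1 + n2 + n3).+1.
  have {}h3 := h3 n (leq_trans (leq_addl _ _) (leqnSn _)).
  have /andP[{}h1 _] := h1 n (leq_trans (leq_addr _ _)
    (leq_trans (leq_addr n3 _) (leqnSn _))).
  have {}h2 := h2 n (leq_trans (leq_addl n1 _) (leq_trans (leq_addr n3 _) (leqnSn _))).
  have nR : 0 < n%:R :> R by rewrite ltr0n.
  move: h3; rewrite /= sub0r normrN normrM normrX ger0_norm; last first.
    by rewrite mulr_ge0// invr_ge0.
  apply/negP; rewrite -leNgt -mulrA ler_pdivlMl// mulr1.
  have -> : `|z| ^+ n = expR (n%:R * (3 * e - L)).
    by rewrite -ez expRM_natl lnK ?posrE.
  apply: (le_trans h2); apply: (@le_trans _ _ (expR (n%:R * (L - e)) *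
    expR (n%:R * (3 * e - L)))); last by rewrite ler_pM2r ?expR_gt0.
  by rewrite -expRD ler_expR -mulrDr ler_pM2l//; lra.
have conv e : 0 < e ->
    ((expR (- L - 2 * e)%R)%:E <=
      radius_of_convergence (fun n => n%:R^-1 * Z n)%R)%E.
  move=> e0; set z := expR _; have z0 : 0 < z by exact: expR_gt0.
  apply: ereal_sup_ubound; exists z; last by rewrite gtr0_norm.
  have [n0 h0] := rate_exp e0.
  pose x := expR (- e); have x0 : 0 < x by exact: expR_gt0.
  pose u n := `|n%:R^-1 * Z n * z ^+ n|.
  have uP n : (n0 <= n)%N -> u n <= x ^+ n.
    move=> /h0 /andP[_ hZ]; rewrite /u ger0_norm; last first.
      by rewrite !mulr_ge0 ?invr_ge0// exprn_ge0// ltW.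
    apply: (@le_trans _ _ (Z n * z ^+ n)).
      apply: ler_wpM2r; first by rewrite exprn_ge0// ltW.
      apply: ler_piMl => //.
      case: n {hZ} => [|n]; first by rewrite invr0.
      by rewrite invf_le1 ?ltr0n// ler1n.
    apply: (@le_trans _ _ (expR (n%:R * (L + e)) * z ^+ n)).
      by rewrite ler_wpM2r// exprn_ge0// ltW.
    rewrite /z /x -[expR _ ^+ n in leLHS]expRM_natl.
    rewrite -[expR _ ^+ n in leRHS]expRM_natl -expRD ler_expR.
    by rewrite -mulrDr ler_wpM2l//; lra.
  (* The geometric bound x^n holds from [n0] on; M enlarges it to cover the finitely many earlier
     terms. *)
  pose M := 1 + \sum_(k < n0) u k / x ^+ k.
  have uM n : u n <= geometric M x n.
    rewrite /geometric /=; have xn : 0 < x ^+ n by rewrite exprn_gt0.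
    have q0 k : 0 <= u k / x ^+ k.
      by apply: divr_ge0; [exact: normr_ge0|exact/exprn_ge0/ltW].
    have s0 : 0 <= \sum_(k < n0) u k / x ^+ k by exact: sumr_ge0.
    have [/uP h|nn0] := leqP n0 n.
      apply: (le_trans h); apply: ler_peMl; first exact: ltW.
      by rewrite lerDl.
    rewrite -ler_pdivrMr// /M (bigD1 (Ordinal nn0))//= addrCA lerDl.
    by rewrite addr_ge0// sumr_ge0.
  have u0 n : 0 <= u n by exact: normr_ge0.
  have g0 n : 0 <= geometric M x n by exact: le_trans (u0 n) (uM n).
  apply: normed_cvg; apply: (series_le_cvg u0 g0 uM).
  apply: is_cvg_geometric_series; rewrite gtr0_norm//.
  by rewrite expR_lt1 oppr_lt0.
move: conv; case: (radius_of_convergence _) => [s| |] conv.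
- rewrite lee_fin; apply/ler_addgt0Pr => e e0.
  have E0 := expR_gt0 (- L).
  (* Chosen so that exp (- L - 2 e1) >= exp (- L) (1 - 2 e1) = exp (- L) - e. *)
  have e1 : 0 < e / (2 * expR (- L)) by rewrite divr_gt0// mulr_gt0.
  have := conv _ e1; rewrite lee_fin expRD.
  have := expR_ge1Dx (- (2 * (e / (2 * expR (- L))))).
  move=> /(ler_wpM2l (ltW E0)); rewrite mulrDr mulr1 mulrN => h1 h2.
  have E1 : expR (- L) * (2 * (e / (2 * expR (- L)))) = e.
    by field; rewrite gt_eqF.
  rewrite E1 in h1; lra.
- by rewrite leey.
- by have := conv 1 ltr01.
Qed.

End exponential_rate.
Theorem theorem5p5 (R : realType) (N : nat) (X : normedModType R)
    (Gamma : probability (strings N) R -> X)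
    (Delta : probability (strings N) R -> R)
    (Gamma_cont : continuous (Gamma : weak_probability N R -> X))
    (Gamma_affine : affine Gamma)
    (Delta_cont : continuous (Delta : weak_probability N R -> R))
    (Delta_affine : affine (Delta : probability (strings N) R -> R^o))
    (Delta_neq0 : forall mu, Delta mu != 0)
    (U : probability (strings N) R -> X)
    (U_def : forall mu, U mu = (Delta mu)^-1 *: Gamma mu)
    (C : set X) (C_closed : closed C) (C_convex : convex_set C)
    (C_meets : C° `&` (U @` [set mu | shift_invariant mu]) !=set0)
    (phi : strings N -> R) (phi_cont : continuous phi) :
  (lower_pressure U C phi = upper_pressure U C phi /\
   upper_pressure U C phi = variational_sup U phi C /\
   upper_pressure U C phi = variational_sup U phi C°) /\
  ((- lne (radius_of_convergence (zeta_coef U C phi)))%E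
     = variational_sup U phi C /\
   (- lne (radius_of_convergence (zeta_coef U C phi)))%E
     = variational_sup U phi C°).
Proof.
have [x [Cx [mu0 inv0 U_mu0]]] := C_meets.
have C_mu0 : C° (U mu0) by rewrite U_mu0.
have U_conv := quotient_convex Gamma_affine Delta_affine Delta_neq0 U_def C_convex.
have U_closed := quotient_closed Gamma_cont Delta_cont Delta_neq0 U_def C_closed.
have U_int := quotient_interior Gamma_cont Delta_cont Delta_neq0 U_def (C := C).
have U_mix (t : {i01 R}) mu : C (U mu) -> t%:num < 1 -> C° (U (pconv t mu mu0)).
  move=> Cmu t1.
  have [s [-> /(_ t1) s1]] :=
    quotient_pconv Gamma_affine Delta_affine Delta_neq0 U_def t mu mu0.
  exact: convex_interior.
pose Z := partition_function U C phi.
have Z_ge0 n : 0 <= Z n.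
  rewrite /Z partition_functionE; apply: sumr_ge0 => i _; case: ifP => // _.
  exact/ltW/cylinder_sup_gt0.
pose frequent c := forall m, exists n,
  [/\ (m <= n)%N, 0 < Z n & c <= n%:R^-1 * ln (Z n)].
have upper c : frequent c -> (c%:E <= variational_sup U phi C)%E.
  move=> /(upper_measure phi_cont U_conv U_closed)[mu [inv Cmu hc]].
  apply: (@le_trans _ _ (entropy (@string_shift N) mu + \int[mu]_x (phi x)%:E)%E).
    rewrite integral_EFin// -leeBlDr// -EFinB; apply: entropy_ge_rate => // q.
    by have := hc q; lra.
  by apply: ereal_sup_ubound; exists mu.
have lower v : (v%:E < variational_sup U phi C°)%E -> exists n0, forall n,
    (n0 <= n)%N -> 0 < Z n /\ v <= n%:R^-1 * ln (Z n).
  move=> lt; apply: contrapT => no; move: lt; apply/negP; rewrite -leNgt.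
  apply: variational_le => // mu inv Cmu l xi mxi; rewrite lee_fin leNgt.
  apply/negP => lt; apply: no.
  have e0 : 0 < entropy_wrt (@string_shift N) mu xi + \int[mu]_x phi x - v.
    by rewrite subr_gt0.
  have [n0 h] := lower_pressure_bound phi_cont inv (U_int _ Cmu)
    (fun m m0 => entropy_wrt_le inv mxi m0) e0.
  by exists n0 => n /h[Zn]; rewrite opprB addrC subrK.
have [M M0 hM] := continuous_bounded phi_cont.
(* The trivial growth bound: there are (N+1)^n words, each contributing at most 2 exp (n M). It
   serves to show that the supremum is finite. *)
pose B := ln 2 + ln (N.+1%:R : R) + M.
have Z_le n : (0 < n)%N -> 0 < Z n -> n%:R^-1 * ln (Z n) <= B.
  move=> n0 Zn; have nR : 0 < n%:R :> R by rewrite ltr0n.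
  rewrite ler_pdivrMl//.
  have Zle : Z n <= (N.+1%:R ^+ n) * (2 * expR (n%:R * M)).
    rewrite /Z partition_functionE -natrX mulr_natl.
    rewrite -[in leRHS](card_ord N.+1) -card_tuple -sumr_const.
    apply: ler_sum => i _; have c0 : 0 < 2 * expR (n%:R * M) by rewrite mulr_gt0 ?expR_gt0.
    case: ifP => _; last exact: ltW.
    have [u [_ hu]] := cylinder_sup_near phi_cont i; apply: (le_trans hu).
    rewrite ler_pM2l// ler_expR; apply: le_trans (ler_norm _) _.
    exact: birkhoff_le.
  have : ln (Z n) <= ln ((N.+1%:R ^+ n) * (2 * expR (n%:R * M))).
    by rewrite ler_ln ?posrE// !mulr_gt0 ?exprn_gt0 ?expR_gt0.
  rewrite lnM ?posrE ?exprn_gt0 ?mulr_gt0 ?expR_gt0//.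
  rewrite lnM ?posrE ?expR_gt0// expRK lnXn// -[ln _ *+ n]mulr_natl => h.
  apply: (le_trans h); rewrite /B !mulrDr.
  have : ln 2 <= n%:R * ln 2 :> R by rewrite ler_peMl ?ler1n// ln_ge0// ler1n.
  lra.
have [L VL] : exists L, variational_sup U phi C° = L%:E.
  case E : (variational_sup U phi C°) => [L| |]; first by exists L.
    have [n0 h] : exists n0, forall n, (n0 <= n)%N ->
      0 < Z n /\ B + 1 <= n%:R^-1 * ln (Z n) by apply: lower; rewrite E ltry.
    have [Zn h1] := h _ (leqnSn n0); have h2 := Z_le _ (ltn0Sn n0) Zn.
    by have := le_trans h1 h2; rewrite gerDl ler10.
  (* The one-atom partition with mu0 already excludes the value [-oo]. *)
  have m0 : measurable_label (fun _ : strings N => ord0 : 'I_1).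
    move=> a; rewrite (_ : _ @^-1` _ = setT)//.
    by apply/seteqP; split=> // u _ /=; rewrite [a]ord1.
  by have := variational_ge phi_cont inv0 C_mu0 m0; rewrite E.
have VCL : variational_sup U phi C = L%:E.
  rewrite -VL; apply/le_anti/andP; split.
    exact: (variational_interior phi_cont inv0 C_mu0 U_mix).
  apply: variational_le => // mu inv Cmu l xi mxi.
  by apply: variational_ge => //; exact: interior_subset.
have rate e : 0 < e -> exists n0, forall n, (n0 <= n)%N ->
    0 < Z n /\ L - e <= n%:R^-1 * ln (Z n) <= L + e.
  move=> e0.
  have [n1 h1] : exists n1, forall n, (n1 <= n)%N ->
      0 < Z n /\ L - e <= n%:R^-1 * ln (Z n).
    by apply: lower; rewrite VL lte_fin; lra.
  have : ~ frequent (L + e) by move=> /upper; rewrite VCL lee_fin; lra.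
  move=> /existsNP[n2 /forallNP h2].
  exists (maxn n1 n2) => n; rewrite geq_max => /andP[/h1[Zn ln1] n2n].
  split=> //; rewrite ln1 /= leNgt; apply/negP => lt.
  by apply: (h2 n); split=> //; exact: ltW.
have [linf lsup] := cvg_limn_einf_sup (rate_cvg rate).
have lo : lower_pressure U C phi = L%:E by exact: linf.
have up : upper_pressure U C phi = L%:E by exact: lsup.
have rad : (- lne (radius_of_convergence (zeta_coef U C phi)))%E = L%:E.
  rewrite /zeta_coef (radius_rate Z_ge0 rate).
  by rewrite lne_EFin ?expR_gt0// expRK -EFinN opprK.
by rewrite lo up rad VL VCL.
Qed.
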